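(* There is a function $f:\mathbb{N}\to\mathbb{N}$ with $f(r)\in O(r^2)$ such that the following holds. Let $r\in\mathbb{N}$ and let $G$ be a graph with a set of terminals $R\subseteq V(G)$. If $G$ has no $r$-decorated tree as a subgraph, then there is a tree-decomposition $(T,\mathcal{B})$ of $G$, $\mathcal{B}=(B_t)_{t\in V(T)}$, whose adhesion-size and whose maximum degree of $T$ are both at most $f(r)$, such that every bag $B_t$, $t\in V(T)$, satisfies at least one of: (1) $|B_t|\le f(r)$; (2) $t$ is a leaf of $T$ with neighbor $t'$, and $B_t\cap R\subseteq B_{t'}$. Moreover, such a decomposition can be computed in polynomial time.
   Context: Given terminals $R$, a graph is $r$-decorated if it is a tree and at least $r$ of its leaves belong to $R$. A tree-decomposition of $G$ is a pair $(T,\mathcal{B})$ with $T$ a tree and $\mathcal{B}=(B_t)_{t\in V(T)}$ subsets of $V(G)$ (possibly empty; $G$ need not be connected) such that $\bigcup_t B_t=V(G)$, every edge of $G$ has both endpoints in some common bag, and for each $v\in V(G)$ the set $\{t: v\in B_t\}$ induces a connected subgraph of $T$. Its adhesion-size is $\max\{|B_t\cap B_{t'}|: tt'\in E(T)\}$. *)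

(* Defs.v *)
(* Mathematical Components *)
From Corelib Require Import BinNums.
From mathcomp Require Import all_boot.
Set Implicit Arguments.
Unset Strict Implicit.
Unset Printing Implicit Defensive.

(* A finite simple graph whose vertex set is a subset of the ambient finite
   type U; the empty graph is allowed.  Subgraphs live on the same type U. *)
Record graph (U : finType) := Graph {
  verts : {set U};
  adj : rel U;
  adj_sym : symmetric adj;
  adj_irr : irreflexive adj;
  adj_verts : forall x y, adj x y -> x \in verts
}.

Definition subgraph (U : finType) (H G : graph U) : Prop :=
  verts H \subset verts G /\ (forall x y, adj H x y -> adj G x y).

Definition induced_adj (U : finType) (G : graph U) (S : {set U}) : rel U :=
  [rel x y | [&& adj G x y, x \in S & y \in S]].

Lemma induced_sym (U : finType) (G : graph U) (S : {set U}) :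
  symmetric (induced_adj G S).
Proof. by move=> x y; rewrite /induced_adj /= adj_sym [(x \in S) && _]andbC. Qed.

Lemma induced_irr (U : finType) (G : graph U) (S : {set U}) :
  irreflexive (induced_adj G S).
Proof. by move=> x; rewrite /induced_adj /= adj_irr. Qed.

Lemma induced_verts (U : finType) (G : graph U) (S : {set U}) (x y : U) :
  induced_adj G S x y -> x \in verts G :&: S.
Proof. by case/and3P=> /adj_verts xG xS _; rewrite inE xG. Qed.

Definition induced (U : finType) (G : graph U) (S : {set U}) : graph U :=
  Graph (induced_sym G S) (induced_irr G S) (@induced_verts U G S).

Definition connected (U : finType) (G : graph U) : Prop :=
  forall x y, x \in verts G -> y \in verts G -> connect (adj G) x y.

(* In path.v a "cycle" of size 2 is an edge traversed back and forth. *)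
Definition acyclic (U : finType) (G : graph U) : Prop :=
  forall c : seq U, cycle (adj G) c -> uniq c -> size c <= 2.

Definition is_tree (U : finType) (G : graph U) : Prop :=
  [/\ verts G != set0, connected G & acyclic G].

Definition degree (U : finType) (G : graph U) (x : U) : nat :=
  #|[set y | adj G x y]|.

Definition max_degree (U : finType) (G : graph U) : nat :=
  \max_(x in verts G) degree G x.

(* The vertex of a one-vertex tree is not a leaf. *)
Definition leaves (U : finType) (G : graph U) : {set U} :=
  [set x in verts G | degree G x == 1].

Definition decorated (U : finType) (R : {set U}) (r : nat) (H : graph U) :
  Prop := is_tree H /\ r <= #|leaves H :&: R|.

(* The values of B outside verts T are irrelevant. *)
Definition tree_decomposition (U W : finType) (G : graph U) (T : graph W)
    (B : W -> {set U}) : Prop :=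
  [/\ is_tree T,
      \bigcup_(t in verts T) B t = verts G,
      (forall x y, adj G x y ->
         exists2 t, t \in verts T & (x \in B t) /\ (y \in B t)) &
      (forall v, v \in verts G -> connected (induced T [set t | v \in B t]))].

Definition adhesion_size (U W : finType) (T : graph W) (B : W -> {set U}) :
  nat := \max_(p : W * W | adj T p.1 p.2) #|B p.1 :&: B p.2|.

Definition bounded_decomposition (U W : finType) (G : graph U) (R : {set U})
    (b : nat) (T : graph W) (B : W -> {set U}) : Prop :=
  [/\ tree_decomposition G T B,
      adhesion_size T B <= b,
      max_degree T <= b &
      forall t, t \in verts T ->
        #|B t| <= b \/
        (t \in leaves T /\
         exists2 t', adj T t t' & B t :&: R \subset B t')].

Definition is_bigO (f g : nat -> nat) : Prop :=
  exists C N : nat, forall n, N <= n -> f n <= C * g n.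

(* Model of computation: a first-order, call-by-value functional language with
   general recursion whose values are binary trees.  A program is a table of
   one-argument functions.  Variables are de Bruijn indices, a function body
   sees only its argument (index 0), and function 0 is the entry point. *)
Inductive data := DNil | DCons (a b : data).

Fixpoint dsize (d : data) : nat :=
  if d is DCons a b then (dsize a + dsize b).+1 else 1.

Definition dhd (d : data) : data := if d is DCons a _ then a else DNil.
Definition dtl (d : data) : data := if d is DCons _ b then b else DNil.
Definition dtrue (d : data) : bool := if d is DCons _ _ then true else false.

Inductive expr :=
  | EVar (i : nat)
  | ENil
  | ECons (e1 e2 : expr)
  | EHd (e : expr)
  | ETl (e : expr)
  | EIf (e e1 e2 : expr)
  | ELet (e1 e2 : expr)
  | ECall (f : nat) (e : expr).

Definition program := seq expr.

(* eval P env e v t: in environment env, e evaluates to v in time t.  Every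
   variable access, construction and projection is charged the full size of
   its result, so that t also bounds the size of every value computed; the
   time is thus polynomially related to that of a Turing machine. *)
Inductive eval (P : program) : seq data -> expr -> data -> nat -> Prop :=
  | eval_var env i :
      eval P env (EVar i) (nth DNil env i) (dsize (nth DNil env i))
  | eval_nil env : eval P env ENil DNil 1
  | eval_cons env e1 e2 v1 v2 t1 t2 :
      eval P env e1 v1 t1 -> eval P env e2 v2 t2 ->
      eval P env (ECons e1 e2) (DCons v1 v2) (t1 + t2 + dsize (DCons v1 v2))
  | eval_hd env e v t :
      eval P env e v t -> eval P env (EHd e) (dhd v) (t + dsize (dhd v))
  | eval_tl env e v t :
      eval P env e v t -> eval P env (ETl e) (dtl v) (t + dsize (dtl v))
  | eval_if env e e1 e2 v w t u :
      eval P env e v t -> eval P env (if dtrue v then e1 else e2) w u ->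
      eval P env (EIf e e1 e2) w (t + u).+1
  | eval_let env e1 e2 v w t u :
      eval P env e1 v t -> eval P (v :: env) e2 w u ->
      eval P env (ELet e1 e2) w (t + u).+1
  | eval_call env f e v w t u :
      eval P env e v t -> eval P [:: v] (nth ENil P f) w u ->
      eval P env (ECall f e) w (t + u).+1.

Definition runs (P : program) (input output : data) (t : nat) : Prop :=
  eval P [:: input] (nth ENil P 0) output t.

Definition enc_seq (X : Type) (enc : X -> data) (s : seq X) : data :=
  foldr (fun x d => DCons (enc x) d) DNil s.

Definition enc_bool (b : bool) : data := if b then DCons DNil DNil else DNil.
Definition enc_bits : seq bool -> data := enc_seq enc_bool.
Definition enc_table : seq (seq bool) -> data := enc_seq enc_bits.

(* Binary digits, least significant first. *)
Fixpoint pos_bits (p : positive) : seq bool :=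
  match p with
  | xH => [:: true]
  | xO q => false :: pos_bits q
  | xI q => true :: pos_bits q
  end.

Definition nat_bits (n : nat) : seq bool :=
  if bin_of_nat n is Npos p then pos_bits p else [::].

(* Vertices are identified with their rank in enum (verts G). *)
Definition enc_graph (U : finType) (G : graph U) : data :=
  enc_table [seq [seq adj G x y | y <- enum (verts G)] | x <- enum (verts G)].

Definition enc_instance (U : finType) (G : graph U) (R : {set U}) (r : nat) :
    data :=
  DCons (enc_graph G)
    (DCons (enc_bits [seq x \in R | x <- enum (verts G)])
           (enc_bits (nat_bits r))).

Definition enc_decomposition (U W : finType) (G : graph U) (T : graph W)
    (B : W -> {set U}) : data :=
  DCons (enc_graph T)
    (enc_table [seq [seq x \in B t | x <- enum (verts G)] |
                 t <- enum (verts T)]).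

(* Main.v *)
(* Explore G in layers.  From the set X of vertices already dealt with and the
   current layer D, let C be D together with everything reachable from it
   through G - R - X.  The next layer D' is the set of unvisited neighbours of
   C, all of which are terminals; if there is none, D' is an arbitrary unvisited
   vertex.  The part of the current component visited so far is spanned by a
   tree, and attaching the vertices of D' to it makes them leaves, so D' has
   fewer than r vertices.  The blocks C partition V(G), and an edge leaving C
   towards a later block ends in D'.  Hence the bags D u D' along a path, each
   with a pendant bag C u D', form a tree-decomposition; C meets R only in D.
   So 2r + 3 bounds everything.  The exploration takes |V(G)| rounds on bit
   vectors, each round being a linear recursion over the adjacency matrix. *)
Require Import Defs.
From mathcomp Require Import all_boot.
From mathcomp Require Import zify.
Set Implicit Arguments.
Unset Strict Implicit.
Unset Printing Implicit Defensive.

(** * Polynomial-time evaluation *)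

Lemma leq_poly (c k a b : nat) : a <= b -> c * a.+1 ^ k <= c * b.+1 ^ k.
Proof. by move=> ab; case: k => // k; rewrite leq_mul2l leq_exp2r ?ltnS ?ab ?orbT. Qed.

Section PolyBounded.
Variables (D : Type) (sz : D -> nat).

(** The base is [(sz d).+1], which is positive, so that a larger exponent never lowers the bound,
    even at size 0. *)
Definition poly_bounded (g : D -> nat) : Prop :=
  exists c k, forall d, g d <= c * (sz d).+1 ^ k.

Lemma poly_bounded_le (g h : D -> nat) :
  (forall d, g d <= h d) -> poly_bounded h -> poly_bounded g.
Proof. by move=> gh [c [k hP]]; exists c, k => d; apply: leq_trans (gh d) (hP d). Qed.

Lemma poly_bounded_const (a : nat) : poly_bounded (fun=> a).
Proof. by exists a, 0 => d; rewrite expn0 muln1. Qed.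

Lemma poly_bounded_size : poly_bounded sz.
Proof. by exists 1, 1 => d; rewrite mul1n expn1. Qed.

Lemma poly_bounded_add (g h : D -> nat) :
  poly_bounded g -> poly_bounded h -> poly_bounded (fun d => g d + h d).
Proof.
case=> c [k gP] [c' [k' hP]]; exists (c + c'), (k + k') => d.
rewrite mulnDl leq_add // ?(leq_trans (gP d)) ?(leq_trans (hP d)) //.
  by rewrite leq_mul2l leq_pexp2l ?leq_addr ?orbT.
by rewrite leq_mul2l leq_pexp2l ?leq_addl ?orbT.
Qed.

Lemma poly_bounded_mul (g h : D -> nat) :
  poly_bounded g -> poly_bounded h -> poly_bounded (fun d => g d * h d).
Proof.
case=> c [k gP] [c' [k' hP]]; exists (c * c'), (k + k') => d.
by rewrite expnD mulnACA leq_mul.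
Qed.

(** Substitutes one polynomial into another; it turns the time bound of a function, stated in the
    size of its argument, into one in the size measure of the caller. *)
Lemma poly_bounded_comp (g h : D -> nat) (c k : nat) :
  (forall d, g d <= c * (h d).+1 ^ k) -> poly_bounded h -> poly_bounded g.
Proof.
move=> gP hP; apply: (poly_bounded_le gP); apply: poly_bounded_mul.
  exact: poly_bounded_const.
elim: k {gP} => [|k IH]; first exact: (poly_bounded_const 1).
apply: poly_bounded_le (poly_bounded_mul (poly_bounded_add hP (poly_bounded_const 1)) IH).
by move=> d; rewrite expnS addn1.
Qed.

End PolyBounded.

Lemma dsize_gt0 (d : data) : 0 < dsize d.
Proof. by case: d. Qed.

Lemma dsize_dhd (d : data) : dsize (dhd d) <= dsize d.
Proof. by case: d => //= a b; lia. Qed.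

Lemma dsize_dtl (d : data) : dsize (dtl d) <= dsize d.
Proof. by case: d => //= a b; lia. Qed.

(** Lets a time bound serve as a size bound for values passed on by [ELet] and [ECall]. *)
Lemma eval_dsize (P : program) (env : seq data) (e : expr) (v : data) (t : nat) :
  eval P env e v t -> dsize v <= t.
Proof. by elim=> //= *; lia. Qed.

Section PolyTime.
Variable P : program.

(* Polynomial time relative to environments of polynomially bounded size; the
   premise makes the property compositional through ELet. *)
Definition poly_time (D : Type) (sz : D -> nat) (env : D -> seq data)
    (e : expr) (val : D -> data) : Prop :=
  (forall i, poly_bounded sz (fun d => dsize (nth DNil (env d) i))) ->
  exists2 T, poly_bounded sz T &
    forall d, exists2 t, eval P (env d) e (val d) t & t <= T d.

(** The index type [D] restricts the claim to arguments of the form [arg d], the well-formed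
    encodings. Time is measured in the encoded argument itself, hence independently of any
    caller. *)
Definition poly_fun (D : Type) (f : nat) (arg val : D -> data) : Prop :=
  exists c k, forall d, exists2 t,
    eval P [:: arg d] (nth ENil P f) (val d) t & t <= c * (dsize (arg d)).+1 ^ k.

Section Expressions.
Variables (D : Type) (sz : D -> nat) (env : D -> seq data).

Lemma poly_time_ext (e : expr) (v w : D -> data) :
  poly_time sz env e v -> (forall d, v d = w d) -> poly_time sz env e w.
Proof.
by move=> eP vw envP; have [T TP H] := eP envP; exists T => // d; rewrite -vw.
Qed.

Lemma poly_time_var (i : nat) :
  poly_time sz env (EVar i) (fun d => nth DNil (env d) i).
Proof. by move=> /(_ i) envP; eexists; [exact: envP | eexists; [constructor|]]. Qed.

Lemma poly_time_nil : poly_time sz env ENil (fun=> DNil).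
Proof.
move=> _; exists (fun=> 1); first exact: poly_bounded_const.
by move=> d; exists 1 => //; constructor.
Qed.

Lemma poly_time_cons (e1 e2 : expr) (v1 v2 : D -> data) :
  poly_time sz env e1 v1 -> poly_time sz env e2 v2 ->
  poly_time sz env (ECons e1 e2) (fun d => DCons (v1 d) (v2 d)).
Proof.
move=> H1 H2 envP; have [T1 T1P {}H1] := H1 envP; have [T2 T2P {}H2] := H2 envP.
exists (fun d => (T1 d + T2 d) + ((T1 d + T2 d) + 1)).
  by do ![apply: poly_bounded_add => //]; apply: poly_bounded_const.
move=> d; have [t1 E1 le1] := H1 d; have [t2 E2 le2] := H2 d.
eexists; first by constructor; [exact: E1 | exact: E2].
by have := eval_dsize E1; have := eval_dsize E2; move=> /=; lia.
Qed.

Lemma poly_time_hd (e : expr) (v : D -> data) :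
  poly_time sz env e v -> poly_time sz env (EHd e) (fun d => dhd (v d)).
Proof.
move=> H envP; have [T TP {}H] := H envP; exists (fun d => T d + T d).
  exact: poly_bounded_add.
move=> d; have [t E le] := H d; eexists; first by constructor; exact: E.
by have := eval_dsize E; have := dsize_dhd (v d); lia.
Qed.

Lemma poly_time_tl (e : expr) (v : D -> data) :
  poly_time sz env e v -> poly_time sz env (ETl e) (fun d => dtl (v d)).
Proof.
move=> H envP; have [T TP {}H] := H envP; exists (fun d => T d + T d).
  exact: poly_bounded_add.
move=> d; have [t E le] := H d; eexists; first by constructor; exact: E.
by have := eval_dsize E; have := dsize_dtl (v d); lia.
Qed.

Lemma poly_time_if (e e1 e2 : expr) (v v1 v2 : D -> data) :
  poly_time sz env e v -> poly_time sz env e1 v1 -> poly_time sz env e2 v2 ->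
  poly_time sz env (EIf e e1 e2) (fun d => if dtrue (v d) then v1 d else v2 d).
Proof.
move=> H H1 H2 envP; have [T TP {}H] := H envP.
have [T1 T1P {}H1] := H1 envP; have [T2 T2P {}H2] := H2 envP.
exists (fun d => T d + (T1 d + T2 d) + 1).
  by do ![apply: poly_bounded_add => //]; apply: poly_bounded_const.
move=> d; have [t E le] := H d; have [t1 E1 le1] := H1 d; have [t2 E2 le2] := H2 d.
exists (t + if dtrue (v d) then t1 else t2).+1; last by case: ifP; lia.
by apply: eval_if E _; case: ifP.
Qed.

Lemma poly_time_let (e1 e2 : expr) (v w : D -> data) :
  poly_time sz env e1 v -> poly_time sz (fun d => v d :: env d) e2 w ->
  poly_time sz env (ELet e1 e2) w.
Proof.
move=> H1 H2 envP; have [T1 T1P {}H1] := H1 envP.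
have [[|i] //=|T2 T2P {}H2] := H2 _.
  (* The new variable has polynomial size because its evaluation time bounds it. *)
  apply: poly_bounded_le T1P => d; have [t E le] := H1 d.
  exact: leq_trans (eval_dsize E) le.
exists (fun d => T1 d + T2 d + 1).
  by do ![apply: poly_bounded_add => //]; apply: poly_bounded_const.
move=> d; have [t1 E1 le1] := H1 d; have [t2 E2 le2] := H2 d.
by eexists; [apply: eval_let E1 E2 | lia].
Qed.

(** Here [phi] translates an index of the caller into the index of the callee that describes the
    argument. *)
Lemma poly_time_call (D' : Type) (arg val : D' -> data) (phi : D -> D')
    (f : nat) (e : expr) (v : D -> data) :
  poly_fun f arg val -> poly_time sz env e v ->
  (forall d, v d = arg (phi d)) ->
  poly_time sz env (ECall f e) (fun d => val (phi d)).
Proof.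
move=> [c [k fP]] H vE envP; have [T TP {}H] := H envP.
exists (fun d => T d + c * (dsize (v d)).+1 ^ k + 1).
  do ![apply: poly_bounded_add => //]; last exact: poly_bounded_const.
  apply: (poly_bounded_comp (fun=> leqnn _)); apply: poly_bounded_le TP => d.
  by have [t E le] := H d; apply: leq_trans (eval_dsize E) le.
move=> d; have [t E le] := H d; have [u E' le'] := fP (phi d).
eexists; first by apply: eval_call E _; rewrite vE; exact: E'.
by rewrite vE; lia.
Qed.

End Expressions.

Lemma poly_fun_of_time (D : Type) (f : nat) (arg val : D -> data) :
  poly_time (dsize \o arg) (fun d => [:: arg d]) (nth ENil P f) val ->
  poly_fun f arg val.
Proof.
case=> [[|i] /=|T [c [k TP]] H]; first exact: poly_bounded_size.
  by rewrite nth_nil; apply: poly_bounded_const.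
exists c, k => d; have [t E le] := H d; exists t => //; exact: leq_trans le (TP d).
Qed.

Definition rec_body (f : nat) (test next step base : expr) : expr :=
  EIf test (ELet (ECall f next) step) base.

(* Linear recursion: [sz] must not grow along [pred] for the cost of one
   level to be bounded by that of the topmost one. *)
Lemma poly_fun_rec (D : Type) (f : nat) (test next step base : expr)
    (arg val tv nv sv bv : D -> data) (sz m : D -> nat) (pred : D -> D) :
  nth ENil P f = rec_body f test next step base ->
  (forall d, sz d <= dsize (arg d)) ->
  (forall d, sz (pred d) <= sz d) ->
  poly_bounded sz (fun d => dsize (arg d)) ->
  poly_bounded sz (fun d => dsize (val d)) ->
  poly_bounded sz m ->
  poly_time sz (fun d => [:: arg d]) test tv ->
  poly_time sz (fun d => [:: arg d]) next nv ->
  poly_time sz (fun d => [:: val (pred d); arg d]) step sv ->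
  poly_time sz (fun d => [:: arg d]) base bv ->
  (forall d, nv d = arg (pred d)) ->
  (forall d, if dtrue (tv d) then m (pred d) < m d /\ val d = sv d
             else val d = bv d) ->
  poly_fun f arg val.
Proof.
move=> bodyE le_arg sz_le argP valP [cm [km mP]] Ht Hn Hs Hb nvE valE.
have envP i : poly_bounded sz (fun d => dsize (nth DNil [:: arg d] i)).
  by case: i => [|i] //=; rewrite nth_nil; apply: poly_bounded_const.
have [T1 T1P {}Ht] := Ht envP; have [T2 T2P {}Hn] := Hn envP.
have [T4 T4P {}Hb] := Hb envP.
have [|T3 T3P {}Hs] := Hs _.
  case=> [|i] /=; last exact: envP i.
  have [c [k cP]] := valP; exists c, k => d; apply: leq_trans (cP _) _.
  exact: leq_poly.
(* The 3 pays for the unit charges of the [EIf], [ELet] and [ECall] of one level. *)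
have [c [k KP]] : poly_bounded sz (fun d => T1 d + T2 d + T3 d + T4 d + 3).
  by do ![apply: poly_bounded_add => //]; apply: poly_bounded_const.
(* The outermost index [d0] stays fixed during the induction, so all levels share one cost bound. *)
have rec_time n d0 d : m d < n -> sz d <= sz d0 ->
    exists2 t, eval P [:: arg d] (nth ENil P f) (val d) t
             & t <= n * (c * (sz d0).+1 ^ k).
  elim: n d => // n IH d; rewrite ltnS => md le_sz.
  have := leq_trans (KP d) (leq_poly c k le_sz); move: (c * _) IH => K IH leK.
  have [t1 E1 le1] := Ht d; have [t2 E2 le2] := Hn d.
  have [t3 E3 le3] := Hs d; have [t4 E4 le4] := Hb d.
  rewrite bodyE mulSn.
  have := valE d; case test_d: (dtrue (tv d)); last first.
    move=> ->.
    exists (t1 + t4).+1; last by lia.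
    by apply: eval_if E1 _; rewrite test_d.
  case=> m_lt ->; have [t5 E5 le5] := IH _ (leq_trans m_lt md)
    (leq_trans (sz_le d) le_sz).
  exists (t1 + ((t2 + t5).+1 + t3).+1).+1; last by lia.
  apply: eval_if E1 _; rewrite test_d; apply: eval_let E3.
  by apply: eval_call E2 _; rewrite nvE.
have [cf [kf totP]] : poly_bounded sz (fun d => (m d).+1 * (c * (sz d).+1 ^ k)).
  apply: poly_bounded_mul; last by exists c, k.
  apply: poly_bounded_le (poly_bounded_add (poly_bounded_const _ 1) _) => //.
  by exists cm, km.
exists cf, kf => d; have [t E le] := rec_time _ d d (leqnn _) (leqnn _).
exists t => //; apply: leq_trans le _; apply: leq_trans (totP d) _.
exact: leq_poly.
Qed.
End PolyTime.

(** * Layering on bit vectors *)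

Fixpoint bits_or (u v : seq bool) : seq bool :=
  if u is a :: u' then (a || head false v) :: bits_or u' (behead v) else [::].

(** The idiom [bits_diff u u] produces the all-false vector of the length of [u]. *)
Fixpoint bits_diff (u v : seq bool) : seq bool :=
  if u is a :: u' then (a && ~~ head false v) :: bits_diff u' (behead v)
  else [::].

(** The recursion consumes [T] along with the rows while [S] stays whole; called with [T] equal to
    [S], it gives the closed neighbourhood. *)
Fixpoint bits_nbhd (rows : seq (seq bool)) (T S : seq bool) : seq bool :=
  if rows is row :: rows' then
    let r := bits_nbhd rows' (behead T) S in
    if head false T then bits_or r row else r
  else S.

(** Only the length of [fuel] matters: the adjacency matrix doubles as a unary counter of the
    vertices. The same device drives [bits_run] and [bits_caterpillar]. *)
Fixpoint bits_closure (fuel M : seq (seq bool)) (S F : seq bool) : seq bool :=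
  if fuel is _ :: fuel' then
    let r := bits_closure fuel' M S F in
    bits_or r (bits_diff (bits_nbhd M r r) F)
  else S.

Fixpoint bits_first (X : seq bool) : seq bool :=
  if X is x :: X' then
    if x then false :: bits_first X' else true :: bits_diff X' X'
  else [::].

(** The updated pair of visited set and layer is the tail of the result, in the shape in which the
    next round of [prog] takes it as the end of its argument. *)
Definition bits_next (M : seq (seq bool)) (R X D : seq bool) :
    seq bool * (seq bool * seq bool) :=
  let C := bits_closure M M D (bits_or R X) in
  let X' := bits_or X C in
  let D' := bits_diff (bits_nbhd M C C) X' in
  (C, (X', if has id D' then D' else bits_first X')).
Fixpoint bits_run (fuel M : seq (seq bool)) (R X D : seq bool) :
    seq (seq bool) :=
  if fuel is _ :: fuel' then
    let s := bits_next M R X D in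
    [:: bits_or D s.2.2, bits_or s.1 s.2.2 & bits_run fuel' M R s.2.1 s.2.2]
  else [:: D].

(** Unfolds one round without expanding [bits_next]. *)
Lemma bits_run_cons (row : seq bool) (fuel M : seq (seq bool))
    (R X D : seq bool) (s := bits_next M R X D) :
  bits_run (row :: fuel) M R X D =
  [:: bits_or D s.2.2, bits_or s.1 s.2.2 & bits_run fuel M R s.2.1 s.2.2].
Proof. by []. Qed.

Definition bits_pad : seq (seq bool) -> seq (seq bool) :=
  map (fun row => [:: false, false & row]).

(** Puts a spine node 0 and its pendant 1 in front of the previous caterpillar, whose nodes move up
    by two, so that 0 is joined to 1 and to the old first node, now 2. *)
Fixpoint bits_caterpillar (fuel : seq (seq bool)) : seq (seq bool) :=
  if fuel is _ :: fuel' then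
    let t := bits_caterpillar fuel' in
    let row := head [::] t in
    [:: [:: false, true, true & bits_diff (behead row) (behead row)],
        [:: true, false & bits_diff row row],
        [:: true, false & row] & bits_pad (behead t)]
  else [:: [:: false]].

Definition bits_main (M : seq (seq bool)) (R : seq bool) :
    seq (seq bool) * seq (seq bool) :=
  let Z := bits_diff R R in (bits_caterpillar M, bits_run M M R Z (bits_first Z)).

Notation V0 := (EVar 0).
Notation V1 := (EVar 1).
Notation ETrue := (ECons ENil ENil).

(* In the step of a [rec_body], V0 is the result of the recursive call and V1
   the argument.  Entries 1 to 10 compute bits_or, bits_diff, bits_nbhd,
   bits_closure, bits_first, has id, bits_run, bits_pad, bits_caterpillar and
   bits_next. *)
Definition prog : program :=
  [:: ELet (ECall 2 (ECons (EHd (ETl V0)) (EHd (ETl V0))))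
        (ECons (ECall 9 (EHd V1))
           (ECall 7 (ECons (EHd V1) (ECons (EHd V1) (ECons (EHd (ETl V1))
                       (ECons V0 (ECall 5 V0)))))));
      rec_body 1 (EHd V0) (ECons (ETl (EHd V0)) (ETl (ETl V0)))
        (ECons (EIf (EHd (EHd V1)) ETrue (EHd (ETl V1))) V0) ENil;
      rec_body 2 (EHd V0) (ECons (ETl (EHd V0)) (ETl (ETl V0)))
        (ECons (EIf (EHd (ETl V1)) ENil (EHd (EHd V1))) V0) ENil;
      rec_body 3 (EHd V0)
        (ECons (ETl (EHd V0)) (ECons (ETl (EHd (ETl V0))) (ETl (ETl V0))))
        (EIf (EHd (EHd (ETl V1))) (ECall 1 (ECons V0 (EHd (EHd V1)))) V0)
        (ETl (ETl V0));
      rec_body 4 (EHd V0) (ECons (ETl (EHd V0)) (ETl V0))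
        (ECall 1 (ECons V0
           (ECall 2 (ECons (ECall 3 (ECons (EHd (ETl V1)) (ECons V0 V0)))
                           (ETl (ETl (ETl V1)))))))
        (EHd (ETl (ETl V0)));
      rec_body 5 V0 (ETl V0)
        (EIf (EHd V1) (ECons ENil V0)
           (ECons ETrue (ECall 2 (ECons (ETl V1) (ETl V1)))))
        ENil;
      rec_body 6 V0 (ETl V0) (EIf (EHd V1) ETrue V0) ENil;
      rec_body 7 (EHd V0)
        (ECons (ETl (EHd V0)) (ECons (EHd (ETl V0)) (ECons (EHd (ETl (ETl V0)))
           (ETl (ECall 10 (ETl V0))))))
        (ELet (ECall 10 (ETl V1))
           (ECons (ECall 1 (ECons (ETl (ETl (ETl (ETl (EVar 2))))) (ETl (ETl V0))))
              (ECons (ECall 1 (ECons (EHd V0) (ETl (ETl V0)))) V1)))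
        (ECons (ETl (ETl (ETl (ETl V0)))) ENil);
      rec_body 8 V0 (ETl V0) (ECons (ECons ENil (ECons ENil (EHd V1))) V0) ENil;
      rec_body 9 V0 (ETl V0)
        (ECons (ECons ENil (ECons ETrue (ECons ETrue
                  (ECall 2 (ECons (ETl (EHd V0)) (ETl (EHd V0)))))))
           (ECons (ECons ETrue (ECons ENil (ECall 2 (ECons (EHd V0) (EHd V0)))))
              (ECons (ECons ETrue (ECons ENil (EHd V0))) (ECall 8 (ETl V0)))))
        (ECons (ECons ENil ENil) ENil);
      ELet (ECall 4 (ECons (EHd V0) (ECons (EHd V0) (ECons (ETl (ETl (ETl V0)))
              (ECall 1 (ECons (EHd (ETl V0)) (EHd (ETl (ETl V0)))))))))
        (ELet (ECall 1 (ECons (EHd (ETl (ETl V1))) V0))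
           (ELet (ECall 2 (ECons (ECall 3 (ECons (EHd (EVar 2)) (ECons V1 V1))) V0))
              (ECons (EVar 2) (ECons V1 (EIf (ECall 6 V0) V0 (ECall 5 V1))))))].

(** * Sizes of encodings and of computed vectors *)

Lemma dtrue_enc_bool (b : bool) : dtrue (enc_bool b) = b.
Proof. by case: b. Qed.

Lemma dtl_enc_seq (X : Type) (enc : X -> data) (s : seq X) :
  dtl (enc_seq enc s) = enc_seq enc (behead s).
Proof. by case: s. Qed.

Lemma dtl_enc_bits (s : seq bool) : dtl (enc_bits s) = enc_bits (behead s).
Proof. exact: dtl_enc_seq. Qed.

Lemma dtl_enc_table (s : seq (seq bool)) :
  dtl (enc_table s) = enc_table (behead s).
Proof. exact: dtl_enc_seq. Qed.

Lemma dhd_enc_bits (s : seq bool) : dhd (enc_bits s) = enc_bool (head false s).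
Proof. by case: s. Qed.

Lemma dhd_enc_table (s : seq (seq bool)) :
  dhd (enc_table s) = enc_bits (head [::] s).
Proof. by case: s. Qed.

Lemma dsize_enc_bits (s : seq bool) :
  size s <= dsize (enc_bits s) <= 4 * size s + 1.
Proof.
elim: s => //= b s /andP[le1 le2]; have : 0 < dsize (enc_bool b) <= 3 by case: b.
by rewrite /enc_bits /= in le1 le2 *; lia.
Qed.

Lemma size_dsize_table (M : seq (seq bool)) : size M <= dsize (enc_table M).
Proof.
by elim: M => //= row M; rewrite /enc_table /=; lia.
Qed.

Lemma dsize_table_behead (M : seq (seq bool)) :
  dsize (enc_table (behead M)) <= dsize (enc_table M).
Proof. by rewrite -dtl_enc_table dsize_dtl. Qed.

Lemma dsize_enc_table (M : seq (seq bool)) (b : nat) :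
  all (fun row => size row <= b) M ->
  dsize (enc_table M) <= size M * (4 * b + 2) + 1.
Proof.
elim: M => //= row M IH /andP[row_b /IH]; have /andP[_] := dsize_enc_bits row.
by rewrite /enc_table /=; lia.
Qed.

Lemma size_bits_or (u v : seq bool) : size (bits_or u v) = size u.
Proof. by elim: u v => //= a u IH v; rewrite IH. Qed.

Lemma size_bits_diff (u v : seq bool) : size (bits_diff u v) = size u.
Proof. by elim: u v => //= a u IH v; rewrite IH. Qed.

Lemma size_bits_nbhd (M : seq (seq bool)) (T S : seq bool) :
  size (bits_nbhd M T S) = size S.
Proof. by elim: M T => //= row M IH T; case: ifP; rewrite ?size_bits_or IH. Qed.

Lemma size_bits_closure (fuel M : seq (seq bool)) (S F : seq bool) :
  size (bits_closure fuel M S F) = size S.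
Proof. by elim: fuel => //= _ fuel IH; rewrite size_bits_or. Qed.

Lemma size_bits_first (X : seq bool) : size (bits_first X) = size X.
Proof. by elim: X => //= x X IH; case: x; rewrite /= ?size_bits_diff ?IH. Qed.

(** The next layer has the length of [D] if it is a neighbourhood and that of [X] if it is a new
    root, hence the maximum. *)
Lemma size_bits_next (M : seq (seq bool)) (R X D : seq bool) :
  [/\ size (bits_next M R X D).1 = size D,
      size (bits_next M R X D).2.1 = size X &
      size (bits_next M R X D).2.2 <= maxn (size X) (size D)].
Proof.
rewrite /bits_next /= size_bits_or size_bits_closure; split=> //.
case: ifP => _; last by rewrite size_bits_first size_bits_or leq_maxl.
by rewrite size_bits_diff size_bits_nbhd size_bits_closure leq_maxr.
Qed.

Ltac expr_time_raw :=
  repeat first [exact: poly_time_nil | exact: poly_time_var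
    | apply: poly_time_cons | apply: poly_time_hd | apply: poly_time_tl
    | apply: poly_time_if].

(* The second branch is for values given in advance, hence only convertible to
   the one read off the expression. *)
Ltac expr_time :=
  first [solve [expr_time_raw]
    | eapply poly_time_ext; [solve [expr_time_raw] | by []]].

(** * Running times of the program entries *)

Lemma poly_bounded_affine (D : Type) (sz g : D -> nat) (a b : nat) :
  (forall d, g d <= a * sz d + b) -> poly_bounded sz g.
Proof.
move=> gP; exists (a + b), 1 => d; apply: leq_trans (gP d) _.
by rewrite expn1; nia.
Qed.

Lemma prog_or : poly_fun prog 1
  (fun d : seq bool * seq bool => DCons (enc_bits d.1) (enc_bits d.2))
  (fun d => enc_bits (bits_or d.1 d.2)).
Proof.
eapply (@poly_fun_rec prog _ 1 _ _ _ _ _ _ _ _ _ _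
  (fun d => size d.1 + size d.2) (fun d => size d.1)
  (fun d => (behead d.1, behead d.2)) erefl).
- move=> [u v] /=; have := dsize_enc_bits u; have := dsize_enc_bits v; lia.
- by move=> [u v] /=; rewrite !size_behead; lia.
- apply: (@poly_bounded_affine _ _ _ 4 3) => -[u v] /=.
  have := dsize_enc_bits u; have := dsize_enc_bits v; lia.
- apply: (@poly_bounded_affine _ _ _ 4 3) => -[u v] /=.
  have := dsize_enc_bits (bits_or u v); rewrite size_bits_or; lia.
- by apply: (@poly_bounded_affine _ _ _ 1 0) => -[u v] /=; lia.
- by expr_time.
- by expr_time.
- by expr_time.
- by expr_time.
- by case=> u v /=; rewrite !dtl_enc_bits.
- case=> -[|a u] v //=; split=> //; rewrite dhd_enc_bits dtrue_enc_bool.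
  by case: a.
Qed.

Lemma prog_diff : poly_fun prog 2
  (fun d : seq bool * seq bool => DCons (enc_bits d.1) (enc_bits d.2))
  (fun d => enc_bits (bits_diff d.1 d.2)).
Proof.
eapply (@poly_fun_rec prog _ 2 _ _ _ _ _ _ _ _ _ _
  (fun d => size d.1 + size d.2) (fun d => size d.1)
  (fun d => (behead d.1, behead d.2)) erefl).
- move=> [u v] /=; have := dsize_enc_bits u; have := dsize_enc_bits v; lia.
- by move=> [u v] /=; rewrite !size_behead; lia.
- apply: (@poly_bounded_affine _ _ _ 4 3) => -[u v] /=.
  have := dsize_enc_bits u; have := dsize_enc_bits v; lia.
- apply: (@poly_bounded_affine _ _ _ 4 3) => -[u v] /=.
  have := dsize_enc_bits (bits_diff u v); rewrite size_bits_diff; lia.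
- by apply: (@poly_bounded_affine _ _ _ 1 0) => -[u v] /=; lia.
1-4: by expr_time.
- by case=> u v /=; rewrite !dtl_enc_bits.
- case=> -[|a u] v //=; split=> //; rewrite dhd_enc_bits dtrue_enc_bool.
  by case: (head false v); rewrite ?andbF ?andbT.
Qed.

Lemma prog_nbhd : poly_fun prog 3
  (fun d : seq (seq bool) * (seq bool * seq bool) =>
     DCons (enc_table d.1) (DCons (enc_bits d.2.1) (enc_bits d.2.2)))
  (fun d => enc_bits (bits_nbhd d.1 d.2.1 d.2.2)).
Proof.
eapply (@poly_fun_rec prog _ 3 _ _ _ _ _ _ _ _ _ _
  (fun d => dsize (enc_table d.1) + size d.2.1 + size d.2.2) (fun d => size d.1)
  (fun d => (behead d.1, (behead d.2.1, d.2.2))) erefl).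
- move=> [M [T S]] /=; have := dsize_enc_bits T; have := dsize_enc_bits S; lia.
- by move=> [M [T S]] /=; have := dsize_table_behead M; rewrite !size_behead; lia.
- apply: (@poly_bounded_affine _ _ _ 4 5) => -[M [T S]] /=.
  have := dsize_enc_bits T; have := dsize_enc_bits S; lia.
- apply: (@poly_bounded_affine _ _ _ 4 3) => -[M [T S]] /=.
  have := dsize_enc_bits (bits_nbhd M T S); rewrite size_bits_nbhd; lia.
- apply: (@poly_bounded_affine _ _ _ 1 0) => -[M [T S]] /=.
  by have := size_dsize_table M; lia.
1-2,4: by expr_time.
- apply: poly_time_if; [by expr_time | | by expr_time].
  eapply (@poly_time_call prog _ _ _ _ _ _ (fun d =>
    (bits_nbhd (behead d.1) (behead d.2.1) d.2.2, head [::] d.1)) 1 _ _ prog_or).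
    by expr_time.
  by case=> M [T S] /=; rewrite dhd_enc_table.
- by case=> M [T S] /=; rewrite dtl_enc_table dtl_enc_bits.
- case=> -[|row M] [T S] //=; split=> //; rewrite dhd_enc_bits dtrue_enc_bool.
  by case: ifP.
Qed.

Lemma prog_closure : poly_fun prog 4
  (fun d : seq (seq bool) * (seq (seq bool) * (seq bool * seq bool)) =>
     DCons (enc_table d.1) (DCons (enc_table d.2.1)
       (DCons (enc_bits d.2.2.1) (enc_bits d.2.2.2))))
  (fun d => enc_bits (bits_closure d.1 d.2.1 d.2.2.1 d.2.2.2)).
Proof.
eapply (@poly_fun_rec prog _ 4 _ _ _ _ _ _ _ _ _ _
  (fun d => dsize (enc_table d.1) + dsize (enc_table d.2.1) +
            size d.2.2.1 + size d.2.2.2) (fun d => size d.1)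
  (fun d => (behead d.1, d.2)) erefl).
- move=> [N [M [T S]]] /=.
  have := dsize_enc_bits T; have := dsize_enc_bits S; lia.
- by move=> [N [M [T S]]] /=; have := dsize_table_behead N; lia.
- apply: (@poly_bounded_affine _ _ _ 4 6) => -[N [M [T S]]] /=.
  have := dsize_enc_bits T; have := dsize_enc_bits S; lia.
- apply: (@poly_bounded_affine _ _ _ 4 3) => -[N [M [T S]]] /=.
  have := dsize_enc_bits (bits_closure N M T S); rewrite size_bits_closure; lia.
- apply: (@poly_bounded_affine _ _ _ 1 0) => -[N [M [T S]]] /=.
  by have := size_dsize_table N; lia.
1-2,4: by expr_time.
- pose r (d : seq (seq bool) * (seq (seq bool) * (seq bool * seq bool))) :=
    bits_closure (behead d.1) d.2.1 d.2.2.1 d.2.2.2.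
  pose q d := bits_nbhd d.2.1 (r d) (r d).
  eapply (@poly_time_call prog _ _ _ _ _ _ (fun d =>
    (r d, bits_diff (q d) d.2.2.2)) 1 _ _ prog_or) => //.
  apply: poly_time_cons; first by expr_time.
  eapply (@poly_time_call prog _ _ _ _ _ _ (fun d =>
    (q d, d.2.2.2)) 2 _ _ prog_diff) => //.
  apply: poly_time_cons; last by expr_time.
  eapply (@poly_time_call prog _ _ _ _ _ _ (fun d =>
    (d.2.1, (r d, r d))) 3 _ _ prog_nbhd) => //.
  by expr_time.
- by case=> N [M [T S]] /=; rewrite dtl_enc_table.
- by case=> -[|row N] [M [T S]].
Qed.

Lemma prog_first : poly_fun prog 5 enc_bits (fun d => enc_bits (bits_first d)).
Proof.
eapply (@poly_fun_rec prog _ 5 _ _ _ _ _ _ _ _ _ _ size size behead erefl).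
- by move=> X; have := dsize_enc_bits X; lia.
- by move=> X; rewrite size_behead; lia.
- by apply: (@poly_bounded_affine _ _ _ 4 1) => X; have := dsize_enc_bits X; lia.
- apply: (@poly_bounded_affine _ _ _ 4 1) => X.
  by have := dsize_enc_bits (bits_first X); rewrite size_bits_first; lia.
- exact: poly_bounded_size.
1-2,4: by expr_time.
- apply: poly_time_if; [by expr_time | by expr_time |].
  apply: poly_time_cons; first by expr_time.
  eapply (@poly_time_call prog _ _ _ _ _ _ (fun d =>
    (behead d, behead d)) 2 _ _ prog_diff); first by expr_time.
  by move=> X /=; rewrite dtl_enc_bits.
- by move=> X /=; rewrite dtl_enc_bits.
- by case=> [|[] X].
Qed.

Lemma prog_has : poly_fun prog 6 enc_bits (fun d => enc_bool (has id d)).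
Proof.
eapply (@poly_fun_rec prog _ 6 _ _ _ _ _ _ _ _ _ _ size size behead erefl).
- by move=> X; have := dsize_enc_bits X; lia.
- by move=> X; rewrite size_behead; lia.
- by apply: (@poly_bounded_affine _ _ _ 4 1) => X; have := dsize_enc_bits X; lia.
- by apply: (@poly_bounded_affine _ _ _ 0 3) => X; case: has.
- exact: poly_bounded_size.
1-4: by expr_time.
- by move=> X /=; rewrite dtl_enc_bits.
- by case=> [|[] X].
Qed.

Lemma prog_next : poly_fun prog 10
  (fun d : seq (seq bool) * (seq bool * (seq bool * seq bool)) =>
     DCons (enc_table d.1) (DCons (enc_bits d.2.1)
       (DCons (enc_bits d.2.2.1) (enc_bits d.2.2.2))))
  (fun d => let s := bits_next d.1 d.2.1 d.2.2.1 d.2.2.2 in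
     DCons (enc_bits s.1) (DCons (enc_bits s.2.1) (enc_bits s.2.2))).
Proof.
apply: poly_fun_of_time.
pose F (d : seq (seq bool) * (seq bool * (seq bool * seq bool))) :=
  bits_or d.2.1 d.2.2.1.
pose C d := bits_closure d.1 d.1 d.2.2.2 (F d).
pose X' d := bits_or d.2.2.1 (C d).
pose N d := bits_nbhd d.1 (C d) (C d).
pose D' d := bits_diff (N d) (X' d).
eapply poly_time_ext; first eapply poly_time_let.
- eapply (@poly_time_call prog _ _ _ _ _ _ (fun d =>
    (d.1, (d.1, (d.2.2.2, F d)))) 4 _ _ prog_closure) => //.
  do 3! [apply: poly_time_cons; first by expr_time].
  eapply (@poly_time_call prog _ _ _ _ _ _ (fun d =>
    (d.2.1, d.2.2.1)) 1 _ _ prog_or) => //.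
  by expr_time.
- apply: poly_time_let.
    eapply (@poly_time_call prog _ _ _ _ _ _ (fun d =>
      (d.2.2.1, C d)) 1 _ _ prog_or) => //.
    by expr_time.
  apply: poly_time_let.
    eapply (@poly_time_call prog _ _ _ _ _ _ (fun d =>
      (N d, X' d)) 2 _ _ prog_diff) => //.
    apply: poly_time_cons; last by expr_time.
    eapply (@poly_time_call prog _ _ _ _ _ _ (fun d =>
      (d.1, (C d, C d))) 3 _ _ prog_nbhd) => //.
    by expr_time.
  do 2! [apply: poly_time_cons; first by expr_time].
  apply: poly_time_if; [| by expr_time |].
    eapply (@poly_time_call prog _ _ _ _ _ _ D' 6 _ _ prog_has) => //.
    by expr_time.
  eapply (@poly_time_call prog _ _ _ _ _ _ X' 5 _ _ prog_first) => //.
  by expr_time.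
- by move=> d /=; rewrite dtrue_enc_bool; congr (DCons _ (DCons _ _)); case: ifP.
Qed.

Lemma size_bits_run (fuel M : seq (seq bool)) (R X D : seq bool) :
  size (bits_run fuel M R X D) = (size fuel).*2.+1 /\
  all (fun row => size row <= maxn (size X) (size D)) (bits_run fuel M R X D).
Proof.
elim: fuel X D => [|row0 fuel IH] X D; first by rewrite /= leq_maxr.
rewrite bits_run_cons.
case: (bits_next M R X D) (size_bits_next M R X D) => C [X' D'] [/= Cs X's D's].
have [-> runP] := IH X' D'; split=> //=.
rewrite !size_bits_or Cs leq_maxr /=; apply: sub_all runP => row.
by rewrite X's; lia.
Qed.

Lemma size_bits_caterpillar (fuel : seq (seq bool)) :
  size (bits_caterpillar fuel) = (size fuel).*2.+1 /\
  all (fun row => size row == (size fuel).*2.+1) (bits_caterpillar fuel).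
Proof.
elim: fuel => //= row0 fuel [].
case: (bits_caterpillar fuel) => //= row t [ts] /andP[/eqP rowE tP].
rewrite !size_bits_diff size_behead size_map ts rowE; split=> //.
rewrite doubleS !eqxx /= all_map; apply: sub_all tP => row' /=.
by move/eqP->.
Qed.

(** The encodings of [X] and [D] may grow from round to round, since a true bit takes more room than
    a false one, but the maximum of their lengths does not; so the measure counts their bits. *)
Lemma prog_run : poly_fun prog 7
  (fun d : seq (seq bool) * (seq (seq bool) * (seq bool * (seq bool * seq bool))) =>
     DCons (enc_table d.1) (DCons (enc_table d.2.1) (DCons (enc_bits d.2.2.1)
       (DCons (enc_bits d.2.2.2.1) (enc_bits d.2.2.2.2)))))
  (fun d => enc_table (bits_run d.1 d.2.1 d.2.2.1 d.2.2.2.1 d.2.2.2.2)).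
Proof.
pose s (d : seq (seq bool) * (seq (seq bool) * (seq bool * (seq bool * seq bool)))) :=
  bits_next d.2.1 d.2.2.1 d.2.2.2.1 d.2.2.2.2.
eapply (@poly_fun_rec prog _ 7 _ _ _ _ _ _ _ _ _ _
  (fun d => dsize (enc_table d.1) + dsize (enc_table d.2.1) +
            size d.2.2.1 + maxn (size d.2.2.2.1) (size d.2.2.2.2))
  (fun d => size d.1)
  (fun d => (behead d.1, (d.2.1, (d.2.2.1, (s d).2)))) erefl).
- move=> [N [M [R [X D]]]] /=.
  move: (dsize_enc_bits R) (dsize_enc_bits X) (dsize_enc_bits D); lia.
- move=> [N [M [R [X D]]]]; have := dsize_table_behead N; rewrite /s.
  cbn [fst snd]; case: (bits_next M R X D) (size_bits_next M R X D).
  by move=> C [X' D'] [/= _ X's D's]; lia.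
- apply: (@poly_bounded_affine _ _ _ 8 10) => -[N [M [R [X D]]]] /=.
  move: (dsize_enc_bits R) (dsize_enc_bits X) (dsize_enc_bits D); lia.
- pose sz (d : seq (seq bool) * (seq (seq bool) * (seq bool * (seq bool * seq bool))))
    := dsize (enc_table d.1) + dsize (enc_table d.2.1) +
       size d.2.2.1 + maxn (size d.2.2.2.1) (size d.2.2.2.2).
  (* There are at most [(sz d).*2.+1] rows of at most [sz d] bits each. *)
  apply: (@poly_bounded_le _ _ _ (fun d => (sz d).*2.+1 * (4 * sz d + 2) + 1)).
    move=> [N [M [R [X D]]]] /=; have [runs runP] := size_bits_run N M R X D.
    apply: leq_trans (dsize_enc_table runP) _; rewrite runs /sz /=.
    by rewrite leq_add2r leq_mul //; have := size_dsize_table N; lia.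
  apply: poly_bounded_add; last exact: poly_bounded_const.
  apply: poly_bounded_mul.
    by apply: (@poly_bounded_affine _ _ _ 2 1) => d; rewrite /sz; lia.
  by apply: (@poly_bounded_affine _ _ _ 4 2) => d; rewrite /sz; lia.
- apply: (@poly_bounded_affine _ _ _ 1 0) => -[N [M [R [X D]]]] /=.
  by have := size_dsize_table N; lia.
- by expr_time.
- do 3! [apply: poly_time_cons; first by expr_time].
  apply: poly_time_tl.
  eapply (@poly_time_call prog _ _ _ _ _ _ (fun d => d.2) 10 _ _ prog_next) => //.
  by expr_time.
- apply: poly_time_let.
    eapply (@poly_time_call prog _ _ _ _ _ _ (fun d => d.2) 10 _ _ prog_next) => //.
    by expr_time.
  apply: poly_time_cons.
    eapply (@poly_time_call prog _ _ _ _ _ _ (fun d =>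
      (d.2.2.2.2, (s d).2.2)) 1 _ _ prog_or) => //.
    by expr_time.
  apply: poly_time_cons; last by expr_time.
  eapply (@poly_time_call prog _ _ _ _ _ _ (fun d =>
    ((s d).1, (s d).2.2)) 1 _ _ prog_or) => //.
  by expr_time.
- by expr_time.
- by move=> d /=; rewrite dtl_enc_table.
- by case=> -[|row N] [M [R [X D]]].
Qed.

Lemma prog_pad : poly_fun prog 8 enc_table (fun d => enc_table (bits_pad d)).
Proof.
eapply (@poly_fun_rec prog _ 8 _ _ _ _ _ _ _ _ _ _
  (dsize \o enc_table) size behead erefl).
- by [].
- by move=> M; apply: dsize_table_behead.
- exact: poly_bounded_size.
- apply: (@poly_bounded_affine _ _ _ 5 0) => M.
  elim: M => //= row M; rewrite /enc_table /=; have := dsize_gt0 (enc_bits row).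
  by rewrite /enc_bits; lia.
- by apply: (@poly_bounded_affine _ _ _ 1 0) => M; have := size_dsize_table M => /=; lia.
1-4: by expr_time.
- by move=> X /=; rewrite dtl_enc_table.
- by case.
Qed.

Lemma prog_caterpillar :
  poly_fun prog 9 enc_table (fun d => enc_table (bits_caterpillar d)).
Proof.
eapply (@poly_fun_rec prog _ 9 _ _ _ _ _ _ _ _ _ _
  (dsize \o enc_table) size behead erefl).
- by [].
- by move=> M; apply: dsize_table_behead.
- exact: poly_bounded_size.
- pose sz := dsize \o enc_table.
  (* The matrix is square, with rows of at most [2 * sz d + 1] bits, and [8 * sz d + 6] is
     [4 * (2 * sz d + 1) + 2]. *)
  apply: (@poly_bounded_le _ _ _ (fun d => (sz d).*2.+1 * (8 * sz d + 6) + 1)).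
    move=> M; have [tE tP] := size_bits_caterpillar M.
    have/dsize_enc_table le1 :
        all (fun row => size row <= (size M).*2.+1) (bits_caterpillar M).
      by apply: sub_all tP => row /eqP->.
    apply: leq_trans le1 _; rewrite tE /sz /= leq_add2r leq_mul //;
    by have := size_dsize_table M; lia.
  apply: poly_bounded_add; last exact: poly_bounded_const.
  apply: poly_bounded_mul.
    by apply: (@poly_bounded_affine _ _ _ 2 1) => d; rewrite /sz /=; lia.
  by apply: (@poly_bounded_affine _ _ _ 8 6) => d; rewrite /sz /=; lia.
- by apply: (@poly_bounded_affine _ _ _ 1 0) => M; have := size_dsize_table M => /=; lia.
1-2,4: by expr_time.
- pose row d := head [::] (bits_caterpillar (behead d)).
  apply: poly_time_cons.
    do 3! [apply: poly_time_cons; first by expr_time].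
    eapply (@poly_time_call prog _ _ _ _ _ _ (fun d =>
      (behead (row d), behead (row d))) 2 _ _ prog_diff); first by expr_time.
    by move=> d; rewrite /= dhd_enc_table dtl_enc_bits.
  apply: poly_time_cons.
    do 2! [apply: poly_time_cons; first by expr_time].
    eapply (@poly_time_call prog _ _ _ _ _ _ (fun d =>
      (row d, row d)) 2 _ _ prog_diff); first by expr_time.
    by move=> d; rewrite /= dhd_enc_table.
  apply: poly_time_cons; first by expr_time.
  eapply (@poly_time_call prog _ _ _ _ _ _ (fun d =>
    behead (bits_caterpillar (behead d))) 8 _ _ prog_pad); first by expr_time.
  by move=> d; rewrite /= dtl_enc_table.
- by move=> X /=; rewrite dtl_enc_table.
- by case=> [|row M] //=; split=> //; rewrite dhd_enc_table.
Qed.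

Lemma prog_main : poly_fun prog 0
  (fun d : seq (seq bool) * (seq bool * seq bool) =>
     DCons (enc_table d.1) (DCons (enc_bits d.2.1) (enc_bits d.2.2)))
  (fun d => DCons (enc_table (bits_main d.1 d.2.1).1)
                  (enc_table (bits_main d.1 d.2.1).2)).
Proof.
apply: poly_fun_of_time.
pose Z (d : seq (seq bool) * (seq bool * seq bool)) := bits_diff d.2.1 d.2.1.
apply: poly_time_let.
  eapply (@poly_time_call prog _ _ _ _ _ _ (fun d =>
    (d.2.1, d.2.1)) 2 _ _ prog_diff) => //.
  by expr_time.
apply: poly_time_cons.
  eapply (@poly_time_call prog _ _ _ _ _ _ (fun d => d.1) 9 _ _ prog_caterpillar) => //.
  by expr_time.
eapply (@poly_time_call prog _ _ _ _ _ _ (fun d =>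
  (d.1, (d.1, (d.2.1, (Z d, bits_first (Z d)))))) 7 _ _ prog_run) => //.
do 4! [apply: poly_time_cons; first by expr_time].
eapply (@poly_time_call prog _ _ _ _ _ _ Z 5 _ _ prog_first) => //.
by expr_time.
Qed.

(** * Trees *)

(** Rotate the cycle to start at [b]: the second and the last entry are neighbours of [b], and they
    differ because there are at least three entries. *)
Lemma cycle_two_neighbors (U : finType) (G : graph U) (c : seq U) (b : U) :
  cycle (adj G) c -> uniq c -> 2 < size c -> b \in c ->
  exists x y, [/\ x != y, x \in c, y \in c, adj G b x & adj G b y].
Proof.
move=> cyc c_uniq c_big bc; have [i p rot_c] := rot_to bc.
have mem_c z : (z \in c) = (z \in b :: p) by rewrite -rot_c mem_rot.
move: cyc c_uniq c_big; rewrite -(rot_cycle i) -(rot_uniq i) -(size_rot i) rot_c.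
case: p mem_c {rot_c} => // x p mem_c.
case/lastP: p mem_c => // p y mem_c /=; rewrite rcons_path last_rcons.
case/andP=> bx /andP[_ yb] /andP[_ /andP[x_p _]] _.
exists x, y; split=> //; last by rewrite adj_sym.
- by apply: contraNneq x_p => ->; rewrite mem_rcons mem_head.
- by rewrite mem_c !inE eqxx orbT.
- by rewrite mem_c !inE mem_rcons mem_head !orbT.
Qed.

Section Graft.
Variables (U : finType) (G H : graph U) (A : {set U}).
Hypotheses (H_sub : subgraph H G) (H_tree : is_tree H).
Hypothesis A_dis : [disjoint A & verts H].
Hypothesis A_nbr : forall a, a \in A -> exists2 y, y \in verts H & adj G a y.

(** One chosen neighbour in [H] for each [a] in [A]; the default [a] is never reached on [A]. *)
Let p (a : U) : U := odflt a [pick y in verts H | adj G a y].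

Let pP (a : U) : a \in A -> p a \in verts H /\ adj G a (p a).
Proof.
move=> /A_nbr[y yH ay]; rewrite /p; case: pickP => [z /andP[]|/(_ y)] //=.
by rewrite yH ay.
Qed.

Let graft_adj : rel U :=
  [rel x y | [|| adj H x y, (x \in A) && (y == p x) | (y \in A) && (x == p y)]].

Let graft_sym : symmetric graft_adj.
Proof. by move=> x y; rewrite /graft_adj /= adj_sym [X in _ || X]orbC. Qed.

Let notA (x : U) : x \in verts H -> (x \in A) = false.
Proof. by move=> xH; rewrite (disjointFl A_dis). Qed.

Let graft_irr : irreflexive graft_adj.
Proof.
move=> x; rewrite /graft_adj /= adj_irr orbb /=; apply/negP => /andP[xA /eqP xp].
by have [] := pP xA; rewrite -xp => /notA; rewrite xA.
Qed.

Let graft_verts (x y : U) : graft_adj x y -> x \in verts H :|: A.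
Proof.
case/or3P=> [/adj_verts xH|/andP[xA _]|/andP[yA /eqP->]]; rewrite inE.
- by rewrite xH.
- by rewrite xA orbT.
- by have [-> _] := pP yA.
Qed.

Let K := Graph graft_sym graft_irr graft_verts.

Let graft_nbr (a y : U) : a \in A -> graft_adj a y = (y == p a).
Proof.
move=> aA; rewrite /graft_adj /= aA /=; case: (boolP (adj H a y)) => [/adj_verts|_].
  by move=> /notA; rewrite aA.
case: eqP => //= _; apply/negP => /andP[yA /eqP ap].
by have [] := pP yA; rewrite -ap => /notA; rewrite aA.
Qed.

(** Each vertex of [A] is joined to its chosen neighbour only, whatever its other edges in [G]. It
    thus has degree one and lies on no cycle, and every cycle of the new graph is one of [H]. *)
Lemma graft : exists K : graph U,
  [/\ subgraph K G, is_tree K, verts K = verts H :|: A & A \subset leaves K].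
Proof.
have [[VHG adjHG] [VH0 H_conn H_acyc]] := (H_sub, H_tree).
exists K; split=> //.
- split=> [|x y] /=.
    rewrite subUset VHG; apply/subsetP => a /pP[_]; exact: adj_verts.
  case/or3P=> [|/andP[xA /eqP->]|/andP[yA /eqP->]]; first exact: adjHG.
    by case: (pP xA).
  by rewrite adj_sym; case: (pP yA).
- split=> /=.
  + by apply: contraNneq VH0 => /eqP; rewrite setU_eq0 => /andP[].
  + have subHK x y : connect (adj H) x y -> connect graft_adj x y.
      by apply: connect_sub => {}x {}y xy; apply: connect1; rewrite /graft_adj /= xy.
    have toH x : x \in verts H :|: A ->
        exists2 y, y \in verts H & connect graft_adj x y.
      case/setUP => [xH|xA]; first by exists x.
      have [pxH _] := pP xA; exists (p x) => //.
      by apply: connect1; rewrite graft_nbr.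
    move=> x y /toH[x' x'H xx'] /toH[y' y'H yy'].
    apply: connect_trans xx' _; apply: connect_trans (subHK _ _ (H_conn _ _ x'H y'H)) _.
    by rewrite (sym_connect_sym graft_sym).
  + move=> c cyc uniq_c; rewrite leqNgt; apply/negP => c_big.
    have cA a : a \in A -> a \notin c.
      move=> aA; apply/negP => ac.
      have [x [y [/eqP xy _ _]]] := cycle_two_neighbors (G := K) cyc uniq_c c_big ac.
      by rewrite /= !graft_nbr // => /eqP xp /eqP yp; case: xy; rewrite xp yp.
    suff cyc' : cycle (adj H) c by have := H_acyc c cyc' uniq_c; lia.
    apply: (sub_in_cycle (P := [pred x | x \in c])) cyc; last exact/allP.
    move=> x y /= xc yc /or3P[//|/andP[xA _]|/andP[yA _]].
      by have := cA _ xA; rewrite xc.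
    by have := cA _ yA; rewrite yc.
- apply/subsetP => a aA; rewrite !inE aA orbT /=; apply/cards1P; exists (p a).
  by apply/setP => y; rewrite !inE /= graft_nbr.
Qed.

End Graft.

Lemma single_tree (U : finType) (G : graph U) (v : U) : v \in verts G ->
  exists H : graph U, [/\ subgraph H G, is_tree H & verts H = [set v]].
Proof.
move=> vG.
have s0 : symmetric (fun _ _ : U => false) by [].
have i0 : irreflexive (fun _ _ : U => false) by [].
have v0 (x y : U) : false -> x \in [set v] by [].
exists (Graph s0 i0 v0); split=> //=.
  by split=> //=; rewrite sub1set.
split=> /=.
- by apply/set0Pn; exists v; rewrite set11.
- by move=> x y /= /set1P-> /set1P->.
- by case=> [|x [|y [|z c]]] //= /andP[].
Qed.

(** Following parents downwards leads every vertex to [ord0], which gives connectedness. The largest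
    vertex of a cycle would have two distinct smaller neighbours, so there is no cycle. *)
Lemma ord_tree (k : nat) (T : graph 'I_k.+1) :
  verts T = setT ->
  (forall b : 'I_k.+1, 0 < b -> exists2 a : 'I_k.+1, a < b & adj T a b) ->
  (forall a a' b : 'I_k.+1,
     a < b -> a' < b -> adj T a b -> adj T a' b -> a = a') ->
  is_tree T.
Proof.
move=> VT parent uniq_parent; split; rewrite ?VT.
- by apply/set0Pn; exists ord0; rewrite inE.
- have to0 (b : 'I_k.+1) : connect (adj T) b ord0.
    have [n] := ubnP (val b); elim: n b => // n IH b; rewrite ltnS => bn.
    have [b0|/parent[a ab adj_ab]] := posnP b.
      by rewrite (_ : b = ord0) //; apply: val_inj.
    apply: connect_trans (connect1 _) (IH a (leq_trans ab bn)).
    by rewrite adj_sym.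
  move=> x y _ _; apply: connect_trans (to0 x) _.
  by rewrite (sym_connect_sym (@adj_sym _ T)).
- move=> c cyc uniq_c; rewrite leqNgt; apply/negP => c_big.
  have [b bc b_max] : exists2 b, b \in c & forall x, x \in c -> x <= b.
    case: c c_big {cyc uniq_c} => // x0 c _.
    have x0c : x0 \in x0 :: c by rewrite mem_head.
    case: (@arg_maxnP _ x0 (mem (x0 :: c)) val x0c) => b bc b_max.
    by exists b.
  have [x [y [/eqP xy xc yc bx by_]]] := cycle_two_neighbors cyc uniq_c c_big bc.
  case: xy; apply: (uniq_parent _ _ b); rewrite 1?[adj T _ b]adj_sym //.
    rewrite ltn_neqAle b_max // andbT; apply: contraTneq bx => /val_inj->.
    by rewrite adj_irr.
  rewrite ltn_neqAle b_max // andbT; apply: contraTneq by_ => /val_inj->.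
  by rewrite adj_irr.
Qed.

(** * Caterpillars *)

Definition cat_edge (a b : nat) : bool :=
  ~~ odd a && ((b == a.+1) || (b == a.+2)).

(* The even nodes form the spine and the odd node [2i+1] hangs off [2i]. *)
Definition cat_adj : rel nat := [rel a b | cat_edge a b || cat_edge b a].

Lemma cat_adjC : symmetric cat_adj.
Proof. by move=> a b; rewrite /cat_adj /= orbC. Qed.

Lemma cat_adj_irr : irreflexive cat_adj.
Proof. by move=> a; rewrite /cat_adj /= orbb /cat_edge; lia. Qed.

(** Matches the shift by two in the recursion of [bits_caterpillar]. *)
Lemma cat_adjSS (a b : nat) : cat_adj a.+2 b.+2 = cat_adj a b.
Proof. by rewrite /cat_adj /cat_edge /= !negbK !eqSS. Qed.

Section Caterpillar.
Variable k : nat.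

Let ord_adj : rel 'I_k := fun a b => cat_adj a b.

Let ord_sym : symmetric ord_adj.
Proof. by move=> a b; apply: cat_adjC. Qed.

Let ord_irr : irreflexive ord_adj.
Proof. by move=> a; apply: cat_adj_irr. Qed.

Let ord_verts (a b : 'I_k) : ord_adj a b -> a \in [set: 'I_k].
Proof. by rewrite inE. Qed.

Definition caterpillar : graph 'I_k := Graph ord_sym ord_irr ord_verts.

Lemma caterpillar_degree (a : 'I_k) : degree caterpillar a <= 3.
Proof.
rewrite /degree cardE -(size_map val).
apply: (@uniq_leq_size _ _ [:: (if odd a then a.-1 else a.+1); a.+2; a - 2]).
  by rewrite map_inj_uniq ?enum_uniq //; apply: val_inj.
move=> _ /mapP[b + ->]; rewrite mem_enum inE /= /ord_adj /cat_adj /cat_edge /= !inE.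
by case: ifP; lia.
Qed.

Lemma caterpillar_leaf (a : 'I_k) : odd a ->
  a \in leaves caterpillar /\
  exists2 b : 'I_k, adj caterpillar a b & val b = a.-1.
Proof.
move=> odd_a; have lt_a : a.-1 < k by have := ltn_ord a; lia.
have nbr (b : 'I_k) : adj caterpillar a b = (val b == a.-1).
  by rewrite /= /ord_adj /cat_adj /cat_edge /= odd_a; lia.
split; last by exists (Ordinal lt_a); rewrite ?nbr /=.
rewrite !inE /=; apply/cards1P; exists (Ordinal lt_a).
by apply/setP => b; rewrite !inE nbr.
Qed.

End Caterpillar.

Lemma caterpillar_tree (k : nat) : is_tree (caterpillar k.+1).
Proof.
apply: ord_tree => //= [b b0|a a' b]; last first.
  rewrite /cat_adj /cat_edge /= => ab a'b adj_ab adj_a'b; apply: ord_inj; lia.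
have lt_b : (if odd b then b.-1 else b - 2) < k.+1.
  by have := ltn_ord b; case: ifP; lia.
exists (Ordinal lt_b) => /=; first by case: ifP; lia.
by rewrite /cat_adj /cat_edge /=; case: ifP; lia.
Qed.

(** * The layered decomposition *)

Section Layers.
Variables (U : finType) (G : graph U) (R : {set U}).
Notation V := (verts G).
Notation state := ({set U} * {set U})%type.

Definition nbhd (S : {set U}) : {set U} :=
  S :|: [set y | [exists x in S, adj G x y]].

(** Vertices of [F] are never entered, but the starting set may meet [F]: the terminals of a layer
    belong to its block. *)
Definition flood_step (F S : {set U}) : {set U} := S :|: (nbhd S :\: F).

Definition flood (D F : {set U}) : {set U} :=
  iter #|V| (flood_step F) D.

(** The choice follows the order of [enum V], in agreement with [bits_first]. *)
Definition new_root (X : {set U}) : {set U} :=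
  if [seq x <- enum V | x \notin X] is x :: _ then [set x] else set0.

(* In a state (X, D), the set X contains the vertices already dealt with and
   D is the current layer; [block] is D with the parts of G - R - X attached
   to it. *)
Definition block (s : state) : {set U} := flood s.2 (R :|: s.1).

Definition advance (s : state) : state :=
  let X := s.1 :|: block s in
  let D := nbhd (block s) :\: X in
  (X, if D != set0 then D else new_root X).

(** Indexed by the nodes of the caterpillar: round [i] owns the spine node [2i] and its pendant
    [2i+1]. *)
Definition bag (s : state) (j : nat) : {set U} :=
  (if odd j then block (iter j./2 advance s) else (iter j./2 advance s).2)
  :|: (iter j./2.+1 advance s).2.

Lemma nbhd_verts (S : {set U}) : S \subset V -> nbhd S \subset V.
Proof.
move=> SV; rewrite subUset SV; apply/subsetP => y; rewrite inE => /existsP[x].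
by case/andP=> _; rewrite adj_sym; apply: adj_verts.
Qed.

Lemma flood_step_sub (F S : {set U}) : S \subset flood_step F S.
Proof. exact: subsetUl. Qed.

Lemma sub_flood (D F : {set U}) : D \subset flood D F.
Proof.
rewrite /flood; elim: #|V| => //= n IH.
exact: subset_trans IH (flood_step_sub _ _).
Qed.

Lemma flood_step_verts (F S : {set U}) : S \subset V -> flood_step F S \subset V.
Proof.
move=> SV; rewrite subUset SV; apply: subset_trans (nbhd_verts SV).
exact: subsetDl.
Qed.

Lemma iter_flood_verts (n : nat) (D F : {set U}) :
  D \subset V -> iter n (flood_step F) D \subset V.
Proof. by move=> DV; elim: n => //= n; apply: flood_step_verts. Qed.

(** Steps only add vertices outside [F]. With [F] the union of [R] and the visited set, this shows
    both that a block avoids visited vertices and that its terminals lie in its layer. *)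
Lemma flood_avoids (D F : {set U}) : flood D F :&: F \subset D.
Proof.
rewrite /flood; elim: #|V| => /= [|n IH]; first exact: subsetIl.
rewrite setIUl subUset IH /=; apply/subsetP => x; rewrite !inE.
by case: (x \in F); rewrite ?andbF.
Qed.

(** Until it is stationary, the iteration gains a vertex at each step, so after [#|V|] steps it is
    stationary or has filled [V]. *)
Lemma flood_closed (D F : {set U}) : D \subset V ->
  nbhd (flood D F) :\: F \subset flood D F.
Proof.
move=> DV; suff : flood_step F (flood D F) = flood D F.
  by move=> {2}<-; apply: subsetUr.
rewrite /flood; set f := flood_step F.
have grow n : f (iter n f D) = iter n f D \/ n <= #|iter n f D|.
  elim: n => [|n [fixed|IH]]; first by right.
    by left; rewrite iterS fixed fixed.
  have [fixed|not_fixed] := eqVneq (f (iter n f D)) (iter n f D).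
    by left; rewrite iterS fixed fixed.
  right; apply: leq_ltn_trans IH _; apply: proper_card.
  by rewrite properEneq eq_sym not_fixed flood_step_sub.
have [//|big] := grow #|V|.
have CV : iter #|V| f D = V.
  by apply/eqP; rewrite eqEcard iter_flood_verts.
apply/eqP; rewrite eqEsubset flood_step_sub andbT CV.
exact: flood_step_verts.
Qed.

Lemma new_rootP (X : {set U}) :
  [/\ new_root X \subset V, [disjoint X & new_root X], #|new_root X| <= 1,
      (new_root X = set0 -> V \subset X) &
      new_root X = set0 \/ exists2 v, v \in V & new_root X = [set v]].
Proof.
rewrite /new_root; case E: [seq x <- enum V | x \notin X] => [|x l].
  split; rewrite ?sub0set ?cards0 //; last by left.
    by rewrite disjoint_sym disjoints_subset sub0set.
  move=> _; apply/subsetP => v vV; apply: contraT => vX.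
  have : v \in [seq x <- enum V | x \notin X] by rewrite mem_filter vX mem_enum.
  by rewrite E.
have : x \in [seq x <- enum V | x \notin X] by rewrite E mem_head.
rewrite mem_filter mem_enum => /andP[xX xV].
split; rewrite ?sub1set ?cards1 //; last by right; exists x.
  by rewrite disjoint_sym disjoints1.
by move=> x0; have := set11 x; rewrite x0 inE.
Qed.

Variable r : nat.
Hypothesis no_decorated :
  ~ (exists2 H : graph U, subgraph H G & decorated R r H).

(* The tree [H] spans the visited part of the current component of [G]. *)
Definition invariant (s : state) : Prop :=
  [/\ s.1 \subset V /\ s.2 \subset V,
      [disjoint s.1 & s.2],
      (s.2 = set0 -> V \subset s.1),
      #|s.2| <= r.+1 &
      s.2 = set0 \/ exists H : graph U,
        [/\ subgraph H G, is_tree H, s.2 \subset verts H &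
            verts H \subset s.1 :|: s.2]].

Lemma invariant_root (X : {set U}) : X \subset V -> invariant (X, new_root X).
Proof.
move=> XV; have [rV rX r1 r0 rE] := new_rootP X; split=> //=.
  exact: leq_trans r1 _.
case: rE => [|[v vV ->]]; [by left | right].
by have [H [HG Ht HE]] := single_tree vV; exists H; rewrite HE subxx subsetUr.
Qed.

(** Every vertex added by a flood step has a neighbour already in the tree, so the new vertices can
    be grafted on step by step. *)
Lemma grow_flood (H : graph U) (D F : {set U}) (n : nat) :
  subgraph H G -> is_tree H -> D \subset verts H ->
  exists H' : graph U, [/\ subgraph H' G, is_tree H' &
    verts H' = verts H :|: iter n (flood_step F) D].
Proof.
move=> HG Ht DH; elim: n => [|n [K [KG Kt KE]]].
  by exists H; split=> //=; apply/esym/setUidPl.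
set S := iter n _ D in KE; set A := (nbhd S :\: F) :\: verts K.
have A_dis : [disjoint A & verts K] by rewrite disjoints_subset subsetDr.
have A_nbr a : a \in A -> exists2 y, y \in verts K & adj G a y.
  rewrite /A KE !inE negb_or -!andbA => /and4P[_ aS _]; rewrite (negPf aS) /=.
  case/existsP=> y /andP[yS ya]; exists y; last by rewrite adj_sym.
  by rewrite inE yS orbT.
have [K' [K'G K't K'E _]] := graft KG Kt A_dis A_nbr.
exists K'; split=> //; rewrite K'E /A iterS -/S /flood_step setUA -KE.
by apply/setP => x; rewrite !inE; case: (x \in verts K).
Qed.

Lemma block_disjoint (s : state) : invariant s -> [disjoint s.1 & block s].
Proof.
case=> _ Xs _ _ _; rewrite disjoint_sym disjoints_subset; apply/subsetP => x xC.
rewrite inE; apply/negP => xX; have := subsetP (flood_avoids s.2 (R :|: s.1)) x.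
by rewrite !inE xC xX orbT (disjointFr Xs xX) => /(_ isT).
Qed.

Lemma block_verts (s : state) : invariant s -> block s \subset V.
Proof. by case=> -[_ DV] _ _ _ _; apply: iter_flood_verts. Qed.

Lemma invariant_advance (s : state) : invariant s -> invariant (advance s).
Proof.
move=> inv_s; have CV := block_verts inv_s.
case: (inv_s) => -[XV DV] XD D0 Dr tree_s.
have X'V : s.1 :|: block s \subset V by rewrite subUset XV.
rewrite /advance; set X := s.1 :|: block s; set D := nbhd (block s) :\: X.
have [_|D_n0] := eqVneq D set0; first exact: invariant_root.
(* A nonterminal neighbour outside the visited set would have been absorbed by the closed block. *)
have DR : D \subset R.
  apply/subsetP => y; rewrite /D /X !inE negb_or -andbA => /and3P[yX yC yN].
  apply: contraR yC => yR; apply: (subsetP (flood_closed (R :|: s.1) DV)).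
  by rewrite /= !inE negb_or yR yX.
have D'V : D \subset V by apply: subset_trans (nbhd_verts CV); apply: subsetDl.
(* An empty layer means that all of [V] was visited, and then [D] would be empty. *)
case: tree_s => [s0|[H [HG Ht DH HX]]].
  case/negP: D_n0; rewrite -subset0 -(setDv V); apply: setDSS => //.
    exact: nbhd_verts.
  exact: subset_trans (D0 s0) (subsetUl _ _).
have [K [KG Kt KE]] := grow_flood (R :|: s.1) #|V| HG Ht DH.
have KX : verts K \subset X.
  rewrite KE subUset subsetUr andbT; apply: subset_trans HX _.
  by rewrite setUS // sub_flood.
have D_dis : [disjoint D & verts K].
  rewrite disjoints_subset; apply: subset_trans (subsetDr _ _) _.
  by rewrite setCS.
have D_nbr a : a \in D -> exists2 y, y \in verts K & adj G a y.
  rewrite /D /X !inE negb_or -andbA => /and3P[_ /negPf-> /= /existsP[y /andP[yC ya]]].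
  by exists y; rewrite 1?adj_sym // KE inE; apply/orP; right.
have [K' [K'G K't K'E Dleaf]] := graft KG Kt D_dis D_nbr.
split=> //=.
- by rewrite disjoint_sym disjoints_subset subsetDr.
- by move=> DE; rewrite DE eqxx in D_n0.
(* All of [D] consists of terminal leaves of [K']. The looser bound [r.+1] accommodates a single
   root without a case distinction on [r]. *)
- rewrite leqNgt; apply/negP => big; apply: no_decorated; exists K' => //.
  split=> //; apply: leq_trans (subset_leq_card _); first exact: ltnW (ltnW big).
  by rewrite subsetI Dleaf.
- by right; exists K'; rewrite K'E subsetUr setSU.
Qed.

Let s0 : state := (set0, new_root set0).
Notation st i := (iter i advance s0).
Notation n := #|V|.

Lemma invariant_iter (i : nat) : invariant (st i).
Proof.
elim: i => [|i IH]; first by apply: invariant_root; apply: sub0set.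
exact: invariant_advance.
Qed.

Lemma visited_mono (i j : nat) : i <= j -> (st i).1 \subset (st j).1.
Proof.
move/subnK <-; elim: (j - i) => //= k IH; exact: subset_trans IH (subsetUl _ _).
Qed.

(** A round with a nonempty layer visits at least one new vertex, and an empty layer means that
    nothing is left. *)
Lemma visited_all (i : nat) : n <= i -> V \subset (st i).1.
Proof.
move=> ni; have [] // : V \subset (st i).1 \/ i <= #|(st i).1|.
  elim: i {ni} => [|i [VX|IH]]; first by right.
    by left; apply: subset_trans VX _; apply: visited_mono.
  have [_ _ D0 _ _] := invariant_iter i.
  have [/D0 VX|/set0Pn[x xD]] := eqVneq (st i).2 set0.
    by left; apply: subset_trans VX _; apply: visited_mono.
  right; apply: leq_ltn_trans IH _; apply: proper_card; rewrite properE.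
  rewrite visited_mono //=; apply/subsetPn; exists x.
    by rewrite inE (subsetP (sub_flood _ _)) ?orbT.
  by have [_ XD _ _ _] := invariant_iter i; rewrite (disjointFl XD).
move=> big; have [[XV _] _ _ _ _] := invariant_iter i.
suff /eqP-> : (st i).1 == V by [].
by rewrite eqEcard XV (leq_trans ni).
Qed.

Lemma layer_final (i : nat) : n <= i -> (st i).2 = set0.
Proof.
move=> ni; have [[_ DV] XD _ _ _] := invariant_iter i; apply/eqP.
rewrite -subset0; apply/subsetP => x xD; have xV := subsetP DV x xD.
by have := disjointFr XD (subsetP (visited_all ni) x xV); rewrite xD.
Qed.

Lemma blockP (x : U) : x \in V -> exists2 i, i < n & x \in block (st i).
Proof.
move/(subsetP (visited_all (leqnn n))).
elim: n => [|k IH] /=; first by rewrite inE.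
rewrite inE => /orP[/IH[i ik xi]|]; last by exists k.
by exists i => //; apply: ltnW.
Qed.

Lemma layer_block (i : nat) : (st i).2 \subset block (st i).
Proof. exact: sub_flood. Qed.

Lemma block_later (i j : nat) (x : U) :
  i < j -> x \in block (st j) -> x \notin (st i.+1).1.
Proof.
move=> ij xj; apply/negP => /(subsetP (visited_mono ij)).
by move/(disjointFr (block_disjoint (invariant_iter j))); rewrite xj.
Qed.

(** Together with [blockP] this makes the blocks a partition of [V]: a block joins the visited set,
    which all later blocks avoid. *)
Lemma block_inj (i j : nat) (x : U) :
  x \in block (st i) -> x \in block (st j) -> i = j.
Proof.
wlog ij : i j / i <= j => [hw xi xj|xi xj].
  by have [ij|/ltnW ij] := leqP i j; [exact: hw | apply/esym; apply: hw].
move: ij; rewrite leq_eqVlt => /predU1P[//|/block_later/(_ xj)].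
by rewrite /= inE xi orbT.
Qed.

Lemma bag_edge (x y : U) : adj G x y ->
  exists2 i, i < n & x \in bag s0 i.*2.+1 /\ y \in bag s0 i.*2.+1.
Proof.
have bag_odd i : bag s0 i.*2.+1 = block (st i) :|: (st i.+1).2.
  by rewrite /bag /= odd_double /= uphalf_double.
move=> xy; have /blockP[i ix xi] := adj_verts xy.
have yx := xy; rewrite adj_sym in yx; have /blockP[j jx yj] := adj_verts yx.
(* By symmetry [x] may be taken in the earlier block; [y] is then in the same block or an unvisited
   neighbour of it. *)
wlog ij : x y i j xy yx xi yj ix jx / i <= j => [hw|].
  have [ij|/ltnW ij] := leqP i j; first exact: hw xi yj ix jx ij.
  by have [l ln [yl xl]] := hw _ _ _ _ yx xy yj xi jx ix ij; exists l.
exists i => //; rewrite bag_odd !inE xi; split=> //.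
move: ij; rewrite leq_eqVlt => /predU1P[->|ij]; first by rewrite yj.
have yN : y \in nbhd (block (st i)) :\: (st i.+1).1.
  rewrite inE (block_later ij yj) !inE; apply/orP; right.
  by apply/existsP; exists x; rewrite xi.
(* The vertex [y] itself shows that the next layer is a neighbourhood and not a new root. *)
by apply/orP; right; rewrite /= ifT //; apply/set0Pn; exists y.
Qed.

Lemma bag_verts (j : nat) : bag s0 j \subset V.
Proof.
rewrite subUset; have [[_ ->] _ _ _ _] := invariant_iter j./2.+1; rewrite andbT.
case: ifP => _; first exact: block_verts (invariant_iter _).
by have [[]] := invariant_iter j./2.
Qed.

(** Two layers have at most [2 * r + 2] vertices; the constant 3 also makes room for the degree of
    the caterpillar. *)
Lemma bag_even_card (j : nat) : ~~ odd j -> #|bag s0 j| <= 2 * r + 3.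
Proof.
move=> /negPf odd_j; rewrite /bag odd_j.
have [_ _ _ le1 _] := invariant_iter j./2.
have [_ _ _ le2 _] := invariant_iter j./2.+1.
by rewrite cardsU; apply: leq_trans (leq_subr _ _) _; lia.
Qed.

Lemma bag_odd_terminals (j : nat) : odd j -> bag s0 j :&: R \subset bag s0 j.-1.
Proof.
move=> odd_j; have [i -> ] : exists i, j = i.*2.+1 by exists j./2; lia.
rewrite /bag /= odd_double /= uphalf_double doubleK setIUl.
apply: setUSS; last exact: subsetIl.
apply: subset_trans (flood_avoids _ (R :|: (st i).1)).
exact: setIS (subsetUl _ _).
Qed.

Let T := caterpillar n.*2.+1.
Let B (t : 'I_n.*2.+1) := bag s0 t.

(** Let [v] lie in block [i]. Outside layer [i] it occurs only in bag [2i+1]. In layer [i] it occurs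
    in bags [2i] and [2i+1] and, if [i] is positive, in [2i-2] and [2i-1]; these nodes induce a path
    in which [2i] can be reached from each. *)
Lemma bag_connected (v : U) : v \in V -> connected (induced T [set t | v \in B t]).
Proof.
move=> vV; have [i i_n vi] := blockP vV.
set I := induced _ _.
have conn1 (t u : 'I_n.*2.+1) : cat_adj t u -> v \in B t -> v \in B u ->
    connect (adj I) t u.
  by move=> tu vt vu; apply: connect1; apply/and3P; split=> //; rewrite inE.
have bagE (t : 'I_n.*2.+1) : v \in B t ->
    (t./2 == i) && (odd t || (v \in (st i).2)) \/
    (t./2.+1 == i) && (v \in (st i).2).
  rewrite /B /bag inE => /orP[|vD]; last first.
    have E := block_inj vi (subsetP (layer_block _) v vD).
    by right; rewrite {2}E vD E eqxx.
  case: ifP => odd_t vD.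
    by left; rewrite (block_inj vi vD) eqxx.
  have E := block_inj vi (subsetP (layer_block _) v vD).
  by left; rewrite {2}E vD E eqxx.
suff [c to_c] : exists c, forall t, v \in B t -> connect (adj I) t c.
  move=> x y /setIP[_ xS] /setIP[_ yS].
  have /to_c xc : v \in B x by move: xS; rewrite inE.
  have /to_c yc : v \in B y by move: yS; rewrite inE.
  apply: connect_trans xc _.
  by rewrite (sym_connect_sym (@adj_sym _ I)).
case: (boolP (v \in (st i).2)) => vD; last first.
  have lt_c : i.*2.+1 < n.*2.+1 by lia.
  exists (Ordinal lt_c) => t /bagE; rewrite (negPf vD) orbF andbF => -[]// /andP[].
  move=> /eqP ti odd_t; rewrite (_ : t = Ordinal lt_c) //.
  by apply: val_inj => /=; lia.
have lt_c : i.*2 < n.*2.+1 by lia.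
exists (Ordinal lt_c) => t vt.
have lt_u : t./2.*2 < n.*2.+1 by have := ltn_ord t; lia.
pose u := Ordinal lt_u.
have vu : v \in B u.
  rewrite /B /u /bag /= odd_double doubleK inE.
  case/bagE: vt => /andP[/eqP ti _]; apply/orP; [left|right].
    by rewrite ti.
  by rewrite -ti in vD.
have vc : v \in B (Ordinal lt_c).
  by rewrite /B /bag /= odd_double doubleK inE vD.
(* A pendant node first moves to its spine node [u], whose bag also contains [v]. *)
apply: (@connect_trans _ _ u).
  have [odd_t|even_t] := boolP (odd t); last first.
    by rewrite (_ : u = t) //; apply: val_inj => /=; lia.
  by apply: conn1 => //=; rewrite /cat_adj /cat_edge /=; lia.
case/bagE: vt => /andP[/eqP ti _].
  by rewrite (_ : u = Ordinal lt_c) //; apply: val_inj; rewrite /= ti.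
by apply: conn1 => //=; rewrite /cat_adj /cat_edge /= -ti; lia.
Qed.

Lemma layered_decomposition : bounded_decomposition G R (2 * r + 3) T B.
Proof.
split.
- split; first exact: caterpillar_tree.
  + apply/eqP; rewrite eqEsubset; apply/andP; split.
      by apply/bigcupsP => t _; apply: bag_verts.
    apply/subsetP => v /blockP[i i_n vi]; apply/bigcupP.
    have lt_c : i.*2.+1 < n.*2.+1 by lia.
    exists (Ordinal lt_c); first by rewrite inE.
    by rewrite /B /bag /= odd_double /= uphalf_double inE vi.
  + move=> x y /bag_edge[i i_n xy]; have lt_c : i.*2.+1 < n.*2.+1 by lia.
    by exists (Ordinal lt_c); [rewrite inE | exact: xy].
  + exact: bag_connected.
- apply/bigmax_leqP => -[a b] /= ab.
  (* Every edge of the caterpillar has an even end, and the bag there is small. *)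
  have [odd_a|even_a] := boolP (odd a).
    apply: leq_trans (subset_leq_card (subsetIr _ _)) _; apply: bag_even_card.
    by move: ab; rewrite /cat_adj /cat_edge /=; lia.
  apply: leq_trans (subset_leq_card (subsetIl _ _)) _; exact: bag_even_card.
- apply/bigmax_leqP => a _; apply: leq_trans (caterpillar_degree a) _; lia.
- move=> t _; have [odd_t|even_t] := boolP (odd t); last first.
    by left; apply: bag_even_card.
  right; have [t_leaf [b tb bE]] := caterpillar_leaf odd_t; split=> //.
  by exists b => //; rewrite /B bE; apply: bag_odd_terminals.
Qed.

End Layers.

(** * From bit vectors to graphs *)

Definition bits (U : finType) (s : seq U) (S : {set U}) : seq bool :=
  [seq x \in S | x <- s].

Lemma bits_or_set (U : finType) (s : seq U) (A B : {set U}) :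
  bits_or (bits s A) (bits s B) = bits s (A :|: B).
Proof. by elim: s => //= x s ->; rewrite inE. Qed.

Lemma bits_diff_set (U : finType) (s : seq U) (A B : {set U}) :
  bits_diff (bits s A) (bits s B) = bits s (A :\: B).
Proof. by elim: s => //= x s ->; rewrite inE andbC. Qed.

(** The rows are indexed by [s] and the columns by [V], so that the induction can shrink the rows
    alone. *)
Lemma bits_nbhd_set (U : finType) (e : rel U) (V s : seq U) (T S : {set U}) :
  bits_nbhd [seq [seq e x y | y <- V] | x <- s] (bits s T) (bits V S) =
  bits V (S :|: [set y | has (fun x => (x \in T) && e x y) s]).
Proof.
elim: s => [|x s IH] /=; first by apply: eq_map => y; rewrite !inE orbF.
rewrite IH; case: ifP => xT //.
rewrite (_ : [seq e x y | y <- V] = bits V [set y | e x y]); last first.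
  by apply: eq_map => y; rewrite inE.
rewrite bits_or_set; congr bits; apply/setP => y; rewrite !inE /=.
by rewrite -orbA [X in _ || X]orbC.
Qed.

(** Uniqueness of [s] ensures that the singleton sets exactly one bit. *)
Lemma bits_first_set (U : finType) (s : seq U) (X : {set U}) : uniq s ->
  bits_first (bits s X) =
  bits s (if [seq x <- s | x \notin X] is x :: _ then [set x] else set0).
Proof.
elim: s => //= x s IH /andP[x_s /IH {}IH]; case: ifP => xX /=.
  rewrite IH; congr (_ :: _); case E: [seq _ <- _ | _] => [|y l]; rewrite inE //.
  have : y \in [seq x <- s | x \notin X] by rewrite E mem_head.
  rewrite mem_filter => /andP[_ ys]; apply/esym/negbTE.
  by apply: contraNneq x_s => ->.
rewrite bits_diff_set inE eqxx; congr (_ :: _); apply/eq_in_map => y ys.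
by rewrite !inE andNb; apply/esym/negbTE; apply: contraNneq x_s => <-.
Qed.

Section Implementation.
Variables (U : finType) (G : graph U) (R : {set U}).
Notation V := (enum (verts G)).
Notation M := [seq [seq adj G x y | y <- V] | x <- V].

Lemma bits_nbhd_graph (S : {set U}) :
  bits_nbhd M (bits V S) (bits V S) = bits V (nbhd G S).
Proof.
rewrite bits_nbhd_set; apply: eq_map => y; rewrite !inE; congr (_ || _).
apply/hasP/existsP => [[x _ xy]|[x /andP[xS xy]]]; exists x; rewrite ?xS //.
by rewrite mem_enum; apply: adj_verts xy.
Qed.

Lemma bits_closure_graph (D F : {set U}) :
  bits_closure M M (bits V D) (bits V F) = bits V (flood G D F).
Proof.
have iterP (N : seq (seq bool)) :
    bits_closure N M (bits V D) (bits V F) =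
    bits V (iter (size N) (flood_step G F) D).
  elim: N => //= _ N ->.
  by rewrite bits_nbhd_graph bits_diff_set bits_or_set.
by rewrite iterP size_map -cardE.
Qed.

Lemma bits_next_graph (X D : {set U}) : D \subset verts G ->
  bits_next M (bits V R) (bits V X) (bits V D) =
  (bits V (block G R (X, D)),
   (bits V (advance G R (X, D)).1, bits V (advance G R (X, D)).2)).
Proof.
move=> DV; rewrite /bits_next /advance /block /=.
rewrite !bits_or_set bits_closure_graph bits_nbhd_graph !bits_or_set bits_diff_set.
congr (_, (_, _)); set D' := _ :\: _.
(* Bits range over [enum (verts G)], so they detect nonemptiness only of subsets of [verts G]; this
   is where [DV] enters. *)
have -> : has id (bits V D') = (D' != set0).
  rewrite has_map; apply/hasP/set0Pn => -[x]; first by exists x.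
  move=> xD'; exists x => //; rewrite mem_enum.
  move: xD'; rewrite inE => /andP[_]; apply/subsetP/nbhd_verts.
  exact: iter_flood_verts.
by case: ifP => // _; rewrite bits_first_set ?enum_uniq.
Qed.

Lemma bagSS (s : {set U} * {set U}) (j : nat) :
  bag G R s j.+2 = bag G R (advance G R s) j.
Proof. by rewrite /bag [odd _]/= negbK [j.+2./2]/= !iterSr. Qed.

(** One round shifts the bag index by two, so the induction applies to the advanced state. The
    second hypothesis makes the last bag equal to its layer alone, which is what [bits_run] outputs
    when the fuel ends. *)
Lemma bits_run_graph (fuel : seq (seq bool)) (s : {set U} * {set U}) :
  (forall i, (iter i (advance G R) s).2 \subset verts G) ->
  (iter (size fuel).+1 (advance G R) s).2 = set0 ->
  bits_run fuel M (bits V R) (bits V s.1) (bits V s.2) =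
  [seq bits V (bag G R s j) | j <- iota 0 (size fuel).*2.+1].
Proof.
elim: fuel s => [|row fuel IH] s sV s_end.
  by rewrite /bag /= in s_end *; rewrite s_end setU0.
rewrite bits_run_cons bits_next_graph ?(sV 0) // -surjective_pairing.
cbn [fst snd]; rewrite !bits_or_set IH; first last.
- by rewrite -s_end -iterSr.
- by move=> i; rewrite -iterSr; apply: (sV i.+1).
have -> : iota 0 (size (row :: fuel)).*2.+1 =
    [:: 0, 1 & map (addn 2) (iota 0 (size fuel).*2.+1)] by rewrite -iotaDl.
move: (iota 0 _) => js; rewrite !map_cons -map_comp; congr [:: _, _ & _].
by apply: eq_map => j; rewrite -bagSS.
Qed.

End Implementation.

Lemma bits_caterpillarE (fuel : seq (seq bool)) (k := (size fuel).*2.+1) :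
  bits_caterpillar fuel =
  [seq [seq cat_adj a b | b <- iota 0 k] | a <- iota 0 k].
Proof.
have diff_id (u : seq bool) : bits_diff u u = nseq (size u) false.
  by elim: u => //= b u ->; rewrite andbN.
have map_false (f : nat -> bool) s : {in s, forall x, f x = false} ->
    nseq (size s) false = [seq f x | x <- s].
  elim: s => //= x s IH fP; rewrite fP ?mem_head // IH // => y ys.
  by rewrite fP // inE ys orbT.
rewrite {}/k; elim: fuel => // row fuel /= ->; set m := (size fuel).*2.
(* The nodes from 3 on are the old nodes from 1 on, moved up by two; their entries follow by
   [cat_adjSS]. *)
rewrite -[iota 3 m]/(iota (2 + 1) m) iotaDl !diff_id /= !size_map.
congr [:: _ :: _ :: _ :: _, _ :: _ :: _ :: _, _ :: _ :: _ :: _ & _].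
- rewrite -map_comp; apply: map_false => b; rewrite mem_iota => /andP[b1 _].
  by rewrite /cat_adj /cat_edge /=; lia.
- rewrite -map_comp; apply: map_false => b; rewrite mem_iota => /andP[b1 _].
  by rewrite /cat_adj /cat_edge /=; lia.
- by rewrite -map_comp; apply: eq_map => b; rewrite /= cat_adjSS.
rewrite /bits_pad -!map_comp; apply/eq_in_map => a; rewrite mem_iota => /andP[a1 _].
have [fst3] : [/\ cat_adj (2 + a) 0 = false, cat_adj (2 + a) 1 = false &
    cat_adj (2 + a) 2 = cat_adj a 0].
  by rewrite /cat_adj /cat_edge /=; split; lia.
move=> snd3 trd3; rewrite /= fst3 snd3 trd3 -map_comp; congr [:: _, _, _ & _].
by apply: eq_map => b; rewrite /= cat_adjSS.
Qed.

Lemma map_enum_ord (X : Type) (f : nat -> X) (k : nat) :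
  [seq f (val i) | i <- enum [set: 'I_k]] = [seq f j | j <- iota 0 k].
Proof. by rewrite enum_setT -enumT -val_enum_ord -map_comp. Qed.

Lemma enc_caterpillar (fuel : seq (seq bool)) (n : nat) : size fuel = n ->
  enc_graph (caterpillar n.*2.+1) = enc_table (bits_caterpillar fuel).
Proof.
move=> <-; rewrite bits_caterpillarE /enc_graph; congr (enc_table _).
rewrite -[RHS]map_enum_ord; apply: eq_map => a.
by rewrite -[RHS]map_enum_ord.
Qed.

Theorem theorem5 :
  exists f : nat -> nat,
    [/\ is_bigO f (fun r => r ^ 2),
        (forall (r : nat) (U : finType) (G : graph U) (R : {set U}),
           R \subset verts G ->
           ~ (exists2 H : graph U, subgraph H G & decorated R r H) ->
           exists (W : finType) (T : graph W) (B : W -> {set U}),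
             bounded_decomposition G R (f r) T B) &
        exists (P : program) (c k : nat),
          forall (r : nat) (U : finType) (G : graph U) (R : {set U}),
            R \subset verts G ->
            ~ (exists2 H : graph U, subgraph H G & decorated R r H) ->
            exists (W : finType) (T : graph W) (B : W -> {set U}) (t : nat),
              [/\ bounded_decomposition G R (f r) T B,
                  runs P (enc_instance G R r) (enc_decomposition G T B) t &
                  t <= c * dsize (enc_instance G R r) ^ k]].
Proof.
exists (fun r => 2 * r + 3); split.
- by exists 5, 1 => n n1; nia.
- move=> r U G R _ noH; do 3!eexists.
  exact: (layered_decomposition noH).
have [c [k main_time]] := prog_main.
(* The bound from [prog_main] is in the size plus one, which is at most twice the size; hence the
   factor [2 ^ k]. *)
exists prog, (c * 2 ^ k), k => r U G R _ noH.
have inv := invariant_iter noH; have final := layer_final noH.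
pose s0 := (set0 : {set U}, new_root G set0).
pose M := [seq [seq adj G x y | y <- enum (verts G)] | x <- enum (verts G)].
pose B (i : 'I_(#|verts G|.*2.+1)) := bag G R s0 i.
have size_M : size M = #|verts G| by rewrite size_map -cardE.
have [t run_t le_t] := main_time (M, (bits (enum (verts G)) R, nat_bits r)).
exists 'I_(#|verts G|.*2.+1), (caterpillar _), B, t; split.
- exact: (layered_decomposition noH).
- suff -> : enc_decomposition G (caterpillar #|verts G|.*2.+1) B =
      DCons (enc_table (bits_main M (bits (enum (verts G)) R)).1)
            (enc_table (bits_main M (bits (enum (verts G)) R)).2) by exact: run_t.
  congr (DCons _ (enc_table _)); first exact: enc_caterpillar.
  (* The all-false vector encodes the empty visited set, so the run starts in the state [s0]. *)
  rewrite /= bits_diff_set setDv bits_first_set ?enum_uniq //.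
  rewrite (bits_run_graph (s := s0)) ?size_M ?final //; last first.
    by move=> i; have [[]] := inv i.
  exact: (map_enum_ord (fun j => bits (enum (verts G)) (bag G R s0 j))).
- apply: leq_trans le_t _; rewrite -mulnA leq_mul2l -expnMn.
  apply/orP; right; have := dsize_gt0 (enc_instance G R r) => dpos.
  case: k {main_time} => // k; rewrite leq_exp2r //.
  by apply: (@leq_trans (dsize (enc_instance G R r)).+1); [exact: leqnn | lia].
Qed.
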